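(* Let $n\ge3$ and let $\vec m(t)$ be the vector of graded multiplicities of the irreducible representations of $D_n$ (the dihedral group of order $2n$) in $A(\Gamma_{D_n})$. Set $$a=\frac{1}{1-((2n+1)t-(2n-1)t^2+t^3)},\quad b=\frac1{1-(t+t^2+t^3)},\quad c=\frac1{1-(3t+t^2-t^3)}.$$ (a) If $n$ is even, then, for the ordering $\chi_{triv},\chi_{1-1},\chi_{-11},\chi_{-1-1},\chi_1,\dots,\chi_{n/2-1}$ of the irreducible characters, $\vec m(t)$ is the column vector with entries $$\tfrac1{2n}a+\tfrac{n-1}{2n}b+\tfrac12c,\quad \tfrac1{2n}a+\tfrac{n-1}{2n}b-\tfrac12c,\quad \tfrac1{2n}(a-b),\quad\tfrac1{2n}(a-b),\quad\tfrac1n(a-b),\ \dots,\ \tfrac1n(a-b).$$ (b) If $n$ is odd, then, for the ordering $\chi_{triv},\chi_{1-1},\chi_1,\dots,\chi_{(n-1)/2}$, $\vec m(t)$ is the column vector with entries $$\tfrac1{2n}a+\tfrac{n-1}{2n}b+\tfrac12c,\quad \tfrac1{2n}a+\tfrac{n-1}{2n}b-\tfrac12c,\quad\tfrac1n(a-b),\ \dots,\ \tfrac1n(a-b).$$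
   Context: Let $k$ be a field of characteristic $0$ over which all irreducible representations of $D_n$ are realized (e.g. $k=\mathbb C$). $A(\Gamma_{D_n})$ is the associative unital $k$-algebra generated by $u,\ v_{i\,i+1},\ w_i$ ($1\le i\le n$, indices in $\mathbb Z/(n)$) with relations, for $1\le i\le n$, 1) $v_{i\,i+1}(w_i-w_{i+1})-w_i^2+w_{i+1}^2=0$; 2) $u(v_{i\,i+1}-v_{i+1\,i+2})-v_{i\,i+1}^2+v_{i+1\,i+2}^2+(v_{i\,i+1}-v_{i+1\,i+2})w_{i+1}=0$. It is graded by word length, $A(\Gamma_{D_n})=\bigoplus_iA(\Gamma_{D_n})_{[i]}$. $D_n\subset S_n$ is generated by $r=(1\,2\cdots n)$ and the reflection $s=(12)(3\,n)(4\,n-1)\cdots$, and acts by graded algebra automorphisms fixing $u$ and permuting the indices of the $w_i$ and of the $v_{i\,i+1}$ (with $v_{ij}=v_{ji}$). The irreducible characters are: $\chi_{triv}$ (trivial); $\chi_{1-1}$ with $r\mapsto1$, $s\mapsto-1$; for $n$ even also $\chi_{-11}$ with $r\mapsto-1$, $s\mapsto1$ and $\chi_{-1-1}$ with $r\mapsto-1$, $s\mapsto-1$; and the $2$-dimensional $\chi_j$ with $\chi_j(r^i)=2\cos(2\pi ij/n)$ and value $0$ on reflections, for $1\le j\le n/2-1$ ($n$ even) or $1\le j\le(n-1)/2$ ($n$ odd). For an irreducible representation $\phi$, its graded multiplicity is $m_\phi(t)=\sum_im_{\phi,i}t^i$, where $m_{\phi,i}$ is the multiplicity of $\phi$ in $A(\Gamma_{D_n})_{[i]}$;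 $\vec m(t)$ is the column vector of the $m_\phi(t)$. *)

(* Defs.v *)
From HB Require Import structures.
From mathcomp Require Import all_boot all_order all_algebra all_fingroup.
From mathcomp Require Import pgroup all_character.
From mathcomp Require Import boolp.
From mathcomp.multinomials Require Import monalg.

Set Implicit Arguments.
Unset Strict Implicit.
Unset Printing Implicit Defensive.

Import GRing.Theory.
Local Open Scope ring_scope.
Local Open Scope quotient_scope.

Section MalgAlgebra.
Variables (k : fieldType) (M : monomType).
Implicit Types x y : {malg k[M]}.

Lemma malgC_comm (c : k) x : x * malgC c = malgC c * x.
Proof.
rewrite !malgM_def fgmulUg fgmulgU; apply: eq_bigr => m _.
by rewrite mulm1 mul1m mulrC.
Qed.

Lemma malg_scalerAr (c : k) x y : c *: (x * y) = x * (c *: y).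
Proof. by rewrite -!mul_malgC !mulrA malgC_comm. Qed.

End MalgAlgebra.

Section FreeAlgebra.
Variables (k : fieldType) (X : choiceType).

Definition freeAlg := {malg k[{fmonom X}]}.
HB.instance Definition _ := GRing.Lalgebra.copy freeAlg {malg k[{fmonom X}]}.
HB.instance Definition _ := GRing.Lalgebra_isAlgebra.Build k freeAlg
  (@malg_scalerAr k {fmonom X}).

Definition freeGen (x : X) : freeAlg := mkmalgU (fmu x) 1.

Variables (B : algType k) (f : X -> B).

Definition word_eval (m : {fmonom X}) : B := \prod_(x <- m) f x.

Fact word_eval_mmorphism : mmorphism word_eval.
Proof.
by split=> [m1 m2|]; rewrite /word_eval ?fmM ?big_cat // fm1 big_nil.
Qed.

HB.instance Definition _ :=
  isMultiplicative.Build _ _ word_eval word_eval_mmorphism.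

(* The algebra morphism [freeAlg -> B] extending [f]. *)
Definition free_eval : freeAlg -> B := mmap (in_alg B) word_eval.

HB.instance Definition _ := GRing.Additive.on free_eval.

Fact free_eval_monoid : monoid_morphism free_eval.
Proof.
have [|e1 e2] := @commr_mmap_is_multiplicative _ _ _ (in_alg B) word_eval.
  by move=> g m m'; rewrite /GRing.comm /= mulr_algl mulr_algr.
by split.
Qed.

HB.instance Definition _ :=
  GRing.isMonoidMorphism.Build _ _ free_eval free_eval_monoid.

Fact free_eval_scalable : scalable free_eval.
Proof. by move=> c x; rewrite /free_eval mmapZ /= mulr_algl. Qed.

HB.instance Definition _ :=
  GRing.isScalable.Build k freeAlg B _ free_eval free_eval_scalable.

Lemma free_evalE x : free_eval (freeGen x) = f x.
Proof. by rewrite /free_eval mmapU /word_eval fmU big_seq1 /= scale1r mul1r. Qed.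

End FreeAlgebra.

Lemma free_ext (k : fieldType) (X : choiceType) (B : algType k)
    (F G : {lrmorphism freeAlg k X -> B}) :
  (forall x, F (freeGen k x) = G (freeGen k x)) -> F =1 G.
Proof.
move=> eqFG a; rewrite (monalgE a) !raddf_sum; apply: eq_bigr => m _ /=.
have -> : mkmalgU m a@_m
    = a@_m *: \prod_(x <- m) freeGen k x :> freeAlg k X.
  rewrite -mul_malgC.
  suff <- : mkmalgU m 1 = \prod_(x <- m) freeGen k x :> freeAlg k X.
    by rewrite malgM_def fgmulUU mulr1 mul1m.
  case: m => s; elim: s => [|x s IHs] /=.
    by rewrite big_nil -fmoneE.
  rewrite big_cons -IHs /freeGen malgM_def fgmulUU mulr1.
  by congr mkmalgU; apply/val_inj; rewrite /= fmM fmU.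
rewrite !linearZ !rmorph_prod /=; congr (_ *: _).
by apply: eq_bigr => x _; apply: eqFG.
Qed.

(* Generators: [None] is u, [Some (inl i)] is v_{i i+1}, [Some (inr i)] is   *)
(* w_i, for i in Z/(n).                                                       *)
Definition gens (n : nat) : finType := option ('Z_n + 'Z_n).

Section Relations.
Variables (n : nat) (B : nzRingType) (g : gens n -> B).

Local Notation u := (g None).
Local Notation v i := (g (Some (inl i))).
Local Notation w i := (g (Some (inr i))).

(* Left-hand sides of the two families of defining relations. *)
Definition drel (j : 'Z_n + 'Z_n) : B :=
  match j with
  | inl i => v i * (w i - w (i + 1)) - w i ^+ 2 + w (i + 1) ^+ 2
  | inr i => u * (v i - v (i + 1)) - v i ^+ 2 + v (i + 1) ^+ 2
             + (v i - v (i + 1)) * w (i + 1)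
  end.
End Relations.

Lemma drel_morph n (B C : nzRingType) (F : {rmorphism B -> C})
    (g : gens n -> B) j : F (drel g j) = drel (F \o g) j.
Proof.
by case: j => i; rewrite /drel /= !(rmorphD, rmorphN, rmorphM, rmorphXn).
Qed.

Lemma eq_drel n (B : nzRingType) (g h : gens n -> B) :
  g =1 h -> drel g =1 drel h.
Proof. by move=> gh [] i; rewrite /drel !gh. Qed.

Lemma mulB_split (R : nzRingType) (a b x y : R) :
  a * b - x * y = a * (b - y) + (a - x) * y.
Proof. by rewrite mulrBr mulrBl addrA subrK. Qed.

(* Locks the operations of the quotient, only to keep unification tractable. *)
Fact dih_key : unit. Proof. exact: tt. Qed.

Section DihedralAlgebra.
Variables (k : fieldType) (n : nat).
Local Notation F := (freeAlg k (gens n)).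

(* The two-sided ideal generated by the relations. *)
Definition dideal : pred F := fun x =>
  `[< exists s : seq (F * ('Z_n + 'Z_n) * F),
        x = \sum_(p <- s) p.1.1 * drel (@freeGen k _) p.1.2 * p.2 >].

Fact dideal_zmod : zmod_closed dideal.
Proof.
split=> [|x y]; first by apply/asboolP; exists [::]; rewrite big_nil.
move=> /asboolP[s ->] /asboolP[t ->]; apply/asboolP.
exists (s ++ [seq (- p.1.1, p.1.2, p.2) | p <- t]).
rewrite big_cat big_map -sumrN; congr (_ + _).
by apply: eq_bigr => p _ /=; rewrite !mulNr.
Qed.

HB.instance Definition _ := GRing.isZmodClosed.Build F dideal dideal_zmod.

Lemma didealMl a x : x \in dideal -> a * x \in dideal.
Proof.
move=> /asboolP[s ->]; apply/asboolP.
exists [seq (a * p.1.1, p.1.2, p.2) | p <- s].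
by rewrite big_map mulr_sumr; apply: eq_bigr => p _ /=; rewrite !mulrA.
Qed.

Lemma didealMr a x : x \in dideal -> x * a \in dideal.
Proof.
move=> /asboolP[s ->]; apply/asboolP.
exists [seq (p.1.1, p.1.2, p.2 * a) | p <- s].
rewrite big_map mulr_suml; apply: eq_bigr => p _.
exact/esym/mulrA.
Qed.

Lemma dideal_rel j : drel (@freeGen k _) j \in dideal.
Proof.
by apply/asboolP; exists [:: (1, j, 1)]; rewrite big_seq1 /= mul1r mulr1.
Qed.

Lemma dideal_eval (B : algType k) (f : gens n -> B) :
  (forall j, drel f j = 0) -> {in dideal, forall x, free_eval f x = 0}.
Proof.
move=> f0 x /asboolP[s ->]; rewrite raddf_sum big1 // => p _ /=.
rewrite !rmorphM drel_morph (@eq_drel _ _ _ f) => [|y /=].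
  by rewrite f0 mulr0 mul0r.
exact: free_evalE.
Qed.

Fact dideal1 : 1 \notin dideal.
Proof.
apply/negP => I1.
have f0 (j : 'Z_n + 'Z_n) : drel (fun=> 0 : k^o) j = 0 :> k^o.
  by case: j => i; rewrite /drel !(mulr0, mul0r, subr0, addr0, expr0n, subrr).
by have /eqP := dideal_eval f0 I1; rewrite rmorph1 oner_eq0.
Qed.

Local Notation dI := (GRing.ZmodClosed.clone F dideal _).

(* The algebra A(Gamma_{D_n}). *)
Definition dihAlg : Type := Quotient.quot dI.

HB.instance Definition _ := GRing.Zmodule.on dihAlg.

Definition dpi (x : F) : dihAlg := \pi_(Quotient.quot dI) x.
Definition drepr (x : dihAlg) : F := generic_quotient.repr (x : Quotient.quot dI).

Lemma dreprK x : dpi (drepr x) = x.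
Proof. exact: reprK. Qed.

Lemma dpi_eq x y : (dpi x = dpi y) <-> (x - y \in dideal).
Proof. by rewrite Quotient.idealrBE; split=> [/eqP//|/eqP]. Qed.

Lemma dreprB x : drepr (dpi x) - x \in dideal.
Proof. by apply/dpi_eq; rewrite dreprK. Qed.

Fact dpi_zmod : zmod_morphism dpi.
Proof. exact: raddfB. Qed.
HB.instance Definition _ := GRing.isZmodMorphism.Build F dihAlg dpi dpi_zmod.

Definition dmul : dihAlg -> dihAlg -> dihAlg :=
  locked_with dih_key (fun x y => dpi (drepr x * drepr y)).
Definition dscale : k -> dihAlg -> dihAlg :=
  locked_with dih_key (fun c x => dpi (c *: drepr x)).

Lemma dpiM x y : dpi (x * y) = dmul (dpi x) (dpi y).
Proof.
rewrite /dmul unlock; apply/esym/dpi_eq.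
rewrite mulB_split; apply: rpredD; [apply: didealMl | apply: didealMr];
  exact: dreprB.
Qed.

Lemma dpiZ c x : dpi (c *: x) = dscale c (dpi x).
Proof.
rewrite /dscale unlock; apply/esym/dpi_eq; rewrite -scalerBr -[_ *: _]mulr_algl.
exact: didealMl (dreprB x).
Qed.

Fact dmulA : associative dmul.
Proof.
by move=> x y z; rewrite -[x]dreprK -[y]dreprK -[z]dreprK -!dpiM mulrA.
Qed.
Fact dmul1x : left_id (dpi 1) dmul.
Proof. by move=> x; rewrite -[x]dreprK -!dpiM mul1r. Qed.
Fact dmulx1 : right_id (dpi 1) dmul.
Proof. by move=> x; rewrite -[x]dreprK -!dpiM mulr1. Qed.
Fact dmulDl : left_distributive dmul +%R.
Proof.
move=> x y z; rewrite -[x]dreprK -[y]dreprK -[z]dreprK.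
by rewrite -raddfD -!dpiM mulrDl raddfD.
Qed.
Fact dmulDr : right_distributive dmul +%R.
Proof.
move=> x y z; rewrite -[x]dreprK -[y]dreprK -[z]dreprK.
by rewrite -raddfD -!dpiM mulrDr raddfD.
Qed.
Fact done_neq0 : dpi 1 != 0.
Proof.
rewrite -(raddf0 dpi); apply/eqP => /dpi_eq; rewrite subr0.
exact/negP/dideal1.
Qed.

HB.instance Definition _ := GRing.Zmodule_isNzRing.Build dihAlg
  dmulA dmul1x dmulx1 dmulDl dmulDr done_neq0.

Fact dpi_monoid : monoid_morphism dpi.
Proof. by split; [|exact: dpiM]. Qed.
HB.instance Definition _ :=
  GRing.isMonoidMorphism.Build F dihAlg dpi dpi_monoid.

Fact dscaleA a b x : dscale a (dscale b x) = dscale (a * b) x.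
Proof. by rewrite -[x]dreprK -!dpiZ scalerA. Qed.
Fact dscale1 : left_id 1 dscale.
Proof. by move=> x; rewrite -[x]dreprK -!dpiZ scale1r. Qed.
Fact dscaleDr : right_distributive dscale +%R.
Proof.
move=> a x y; rewrite -[x]dreprK -[y]dreprK.
by rewrite -raddfD -!dpiZ scalerDr raddfD.
Qed.
Fact dscaleDl x : {morph dscale^~ x : a b / a + b}.
Proof. by move=> a b; rewrite -[x]dreprK -!dpiZ scalerDl raddfD. Qed.

HB.instance Definition _ := GRing.Zmodule_isLmodule.Build k dihAlg
  dscaleA dscale1 dscaleDr dscaleDl.

Fact dpi_scalable : scalable dpi.
Proof. by move=> c x; rewrite dpiZ. Qed.
HB.instance Definition _ := GRing.isScalable.Build k F dihAlg _ dpi dpi_scalable.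

Fact dscaleAl a (x y : dihAlg) : a *: (x * y) = (a *: x) * y.
Proof.
rewrite -[x]dreprK -[y]dreprK.
by rewrite -rmorphM -!linearZ -rmorphM; congr (dpi _); apply: scalerAl.
Qed.
HB.instance Definition _ := GRing.Lmodule_isLalgebra.Build k dihAlg dscaleAl.

Fact dscaleAr a (x y : dihAlg) : a *: (x * y) = x * (a *: y).
Proof.
rewrite -[x]dreprK -[y]dreprK.
by rewrite -rmorphM -!linearZ -rmorphM; congr (dpi _); apply: scalerAr.
Qed.
HB.instance Definition _ := GRing.Lalgebra_isAlgebra.Build k dihAlg dscaleAr.


Definition dgen (x : gens n) : dihAlg := dpi (freeGen k x).

Lemma dgen_rel j : drel dgen j = 0.
Proof.
rewrite -[dgen]/(dpi \o @freeGen k _) -drel_morph -(raddf0 dpi).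
by apply/dpi_eq; rewrite subr0 dideal_rel.
Qed.

Section Lift.
Variables (B : algType k) (f : gens n -> B).

Definition dlift : dihAlg -> B :=
  locked_with dih_key (fun x => free_eval f (drepr x)).

Hypothesis f_rel : forall j, drel f j = 0.

Lemma dlift_pi x : dlift (dpi x) = free_eval f x.
Proof.
rewrite /dlift unlock; apply/eqP; rewrite -subr_eq0 -raddfB; apply/eqP.
by apply: dideal_eval (dreprB x).
Qed.

Lemma dlift_linear : linear dlift.
Proof.
move=> c x y; rewrite -[x]dreprK -[y]dreprK -linearP !dlift_pi.
exact: linearP.
Qed.

Lemma dlift_monoid : monoid_morphism dlift.
Proof.
split=> [|x y]; first by rewrite -(rmorph1 dpi) dlift_pi rmorph1.
by rewrite -[x]dreprK -[y]dreprK -rmorphM !dlift_pi rmorphM.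
Qed.

Lemma dlift_gen x : dlift (dgen x) = f x.
Proof. by rewrite dlift_pi free_evalE. Qed.

End Lift.

Lemma dihAlg_ext (B : algType k) (f g : {lrmorphism dihAlg -> B}) :
  (forall x, f (dgen x) = g (dgen x)) -> f =1 g.
Proof.
move=> eqfg x; rewrite -[x]dreprK.
by apply: (free_ext (F := f \o dpi) (G := g \o dpi)).
Qed.

End DihedralAlgebra.

Section DihedralGroup.
Variable n : nat.

Definition drot : {perm 'Z_n} := perm (addIr (1 : 'Z_n)).
Definition dref : {perm 'Z_n} := perm (can_inj (subKr (3%:R : 'Z_n))).

Definition dihedral : {group {perm 'Z_n}} := <<[set drot; dref]>>%G.

Lemma drotE i : drot i = i + 1. Proof. by rewrite permE. Qed.
Lemma drefE i : dref i = 3%:R - i. Proof. by rewrite permE. Qed.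

Lemma dihedral_adj g : g \in dihedral ->
  (forall i, g (i + 1) = g i + 1) \/ (forall i, g (i + 1) = g i - 1).
Proof.
case/gen_prodgP=> m [c c_in ->{g}].
elim: m c c_in => [|m IHm] c c_in.
  by left=> i; rewrite big_ord0 !perm1.
rewrite big_ord_recr /=.
have [|IH|IH] := IHm (fun i => c (widen_ord (leqnSn m) i)); first by move=> i.
  have /set2P[->|->] := c_in ord_max; [left|right] => i; rewrite !permM IH.
    by rewrite !drotE.
  by rewrite !drefE opprD addrA.
have /set2P[->|->] := c_in ord_max; [right|left] => i; rewrite !permM IH.
  by rewrite !drotE addrAC.
by rewrite !drefE opprB addrCA addrC.
Qed.

(* [edge i j] is the index of v_{ij} = v_{ji} when j = i + 1 or i = j + 1. *)
Definition edge (i j : 'Z_n) : 'Z_n := if j == i + 1 then i else j.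

Definition gens_act (g : {perm 'Z_n}) (x : gens n) : gens n :=
  match x with
  | None => None
  | Some (inl i) => Some (inl (edge (g i) (g (i + 1))))
  | Some (inr i) => Some (inr (g i))
  end.

Hypothesis n_gt2 : (2 < n)%N.

Fact Zn2_neq0 : 1 + 1 != 0 :> 'Z_n.
Proof.
have := val_Zp_nat (ltnW n_gt2) 2; rewrite modn_small // => val2.
by apply/eqP => e0; rewrite -[2%:R]/(1 + 1) e0 in val2.
Qed.

Lemma edge_succ i : edge i (i + 1) = i.
Proof. by rewrite /edge eqxx. Qed.

Lemma edge_pred i : edge i (i - 1) = i - 1.
Proof.
rewrite /edge (can2_eq (subrK 1) (addrK 1)) -addrA eq_sym addrC -subr_eq0 addrK.
by rewrite (negPf Zn2_neq0).
Qed.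

Lemma edge_subl i : edge (i - 1) i = i - 1.
Proof. by rewrite -[X in edge _ X](subrK 1) edge_succ. Qed.

Lemma edge_addl i : edge (i + 1) i = i.
Proof. by rewrite -[X in edge _ X](addrK 1) edge_pred addrK. Qed.

Lemma gens_act1 : gens_act 1%g =1 id.
Proof. by case=> [[i|i]|] //=; rewrite !perm1 ?edge_succ. Qed.

Lemma gens_actM g h : g \in dihedral -> h \in dihedral ->
  gens_act (g * h)%g =1 gens_act h \o gens_act g.
Proof.
move=> /dihedral_adj g_adj /dihedral_adj h_adj [[i|i]|] //=; last first.
  by rewrite permM.
have hB (e : forall i, h (i + 1) = h i - 1) j : h (j - 1) = h j + 1.
  by rewrite -[in RHS](subrK 1 j) e subrK.
have hB' (e : forall i, h (i + 1) = h i + 1) j : h (j - 1) = h j - 1.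
  by rewrite -[in RHS](subrK 1 j) e addrK.
congr (Some (inl _)); rewrite !permM.
case: g_adj => ->; case: h_adj => eh.
- by rewrite edge_succ !eh.
- by rewrite edge_succ !eh.
- by rewrite edge_pred subrK (hB' eh) edge_pred edge_subl.
by rewrite edge_pred subrK (hB eh) edge_succ edge_addl.
Qed.

Lemma drel_gens_act (B : nzRingType) (f : gens n -> B) g : g \in dihedral ->
  (forall j, drel f j = 0) -> forall j, drel (f \o gens_act g) j = 0.
Proof.
move=> /dihedral_adj[gS|gP] f0 [] i /=.
- by rewrite !gS !edge_succ; apply: (f0 (inl _)).
- by rewrite !gS !edge_succ; apply: (f0 (inr _)).
- rewrite !gP !edge_pred; have /= := f0 (inl (g i - 1)); rewrite subrK => e.
  by apply: oppr_inj; rewrite oppr0 -[RHS]e !opprD !opprK -mulrN opprB addrAC.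
rewrite !gP !edge_pred; have /= := f0 (inr (g i - 1 - 1)); rewrite subrK => e.
apply: oppr_inj; rewrite oppr0 -[RHS]e !opprD !opprK.
rewrite -mulrN opprB; congr (_ + _); first exact: addrAC.
by rewrite -mulNr opprB.
Qed.

End DihedralGroup.

Section DihedralAction.
Variables (k : fieldType) (n : nat).
Local Notation A := (dihAlg k n).
Local Notation D := (dihedral n).

(* For 2 < n and g in D_n this is the algebra automorphism of A induced by   *)
(* [gens_act g] (see [dact_gen], [dact_linear] and [dact_monoid]).  As        *)
(* (g * h) i = h (g i) in {perm _}, g |-> [dact g] is a right action, which   *)
(* is what mx_representation encodes with row vectors.                        *)
Definition dact (g : {perm 'Z_n}) : A -> A := dlift (@dgen k n \o gens_act g).

Hypothesis n_gt2 : (2 < n)%N.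

Lemma dact_rel g : g \in D -> forall j, drel (@dgen k n \o gens_act g) j = 0.
Proof. by move=> Dg; have := @drel_gens_act n n_gt2 A (@dgen k n) g Dg (@dgen_rel k n). Qed.

Lemma dact_gen g x : g \in D -> dact g (dgen k x) = dgen k (gens_act g x).
Proof. by move/dact_rel=> gr; rewrite /dact dlift_gen. Qed.

Lemma dact_linear g : g \in D -> linear (dact g).
Proof. by move/dact_rel/dlift_linear. Qed.

Lemma dact_monoid g : g \in D -> monoid_morphism (dact g).
Proof. by move/dact_rel/dlift_monoid. Qed.

Definition word (s : seq (gens n)) : A := \prod_(x <- s) dgen k x.

Lemma dact_word g s : g \in D -> dact g (word s) = word (map (gens_act g) s).
Proof.
move=> Dg; have [g1 gM] := dact_monoid Dg.
rewrite /word big_map; elim: s => [|x s IHs]; rewrite ?big_nil // !big_cons.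
by rewrite gM IHs dact_gen.
Qed.

Lemma dact_sum g (I : finType) (c : I -> k) (v : I -> A) : g \in D ->
  dact g (\sum_i c i *: v i) = \sum_i c i *: dact g (v i).
Proof.
move=> Dg; have gL := dact_linear Dg.
have g0 : dact g 0 = 0.
  by have := gL (-1) 0 0; rewrite scaler0 addr0 scaleN1r addNr.
have gD x y : dact g (x + y) = dact g x + dact g y.
  by have := gL 1 x y; rewrite !scale1r.
rewrite (big_morph (dact g) gD g0); apply: eq_bigr => i _.
by have := gL (c i) (v i) 0; rewrite g0 !addr0.
Qed.

(* The component of degree d for word length. *)
Definition Agr (d : nat) (x : A) : Prop :=
  exists c : d.-tuple (gens n) -> k, x = \sum_t c t *: word t.

Lemma Agr_act d g x : g \in D -> Agr d x -> Agr d (dact g x).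
Proof.
move=> Dg [c ->].
have gK : cancel (gens_act g) (gens_act g^-1%g).
  move=> x0; rewrite -[LHS]/((gens_act g^-1%g \o gens_act g) x0).
  by rewrite -gens_actM ?groupV // mulgV gens_act1.
have gK' : cancel (gens_act g^-1%g) (gens_act g).
  move=> x0; rewrite -[LHS]/((gens_act g \o gens_act g^-1%g) x0).
  by rewrite -gens_actM ?groupV // mulVg gens_act1.
exists (fun t => c (map_tuple (gens_act g^-1%g) t)).
rewrite dact_sum // [RHS](reindex (map_tuple (gens_act g))) /=; last first.
  exists (map_tuple (gens_act g^-1%g)) => t _; apply/val_inj.
    by rewrite /= mapK.
  by rewrite /= mapK.
apply: eq_bigr => t _; rewrite dact_word //.
by congr (c _ *: _); apply/val_inj; rewrite /= mapK.
Qed.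

Lemma dactM d g h x : g \in D -> h \in D -> Agr d x ->
  dact (g * h)%g x = dact h (dact g x).
Proof.
move=> Dg Dh [c ->]; rewrite !dact_sum ?groupM //.
apply: eq_bigr => t _; rewrite !dact_word ?groupM //; congr (_ *: word _).
by rewrite -map_comp; apply: eq_map => y; apply: gens_actM.
Qed.

Lemma dact1 d x : Agr d x -> dact 1%g x = x.
Proof.
case=> c ->; rewrite dact_sum ?group1 //; apply: eq_bigr => t _.
rewrite dact_word ?group1 //; congr (_ *: word _).
by rewrite (eq_map (gens_act1 (n := n))) map_id.
Qed.

End DihedralAction.

Section Basis.
Variables (k : fieldType) (V : lmodType k).

Definition is_basis (P : V -> Prop) (N : nat) (b : 'I_N -> V) : Prop :=
  (forall x, P x <-> exists c : 'I_N -> k, x = \sum_i c i *: b i) /\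
  (forall c : 'I_N -> k, \sum_i c i *: b i = 0 -> forall i, c i = 0).

Lemma finite_basis (P : V -> Prop) (I : finType) (f : I -> V) :
    (forall x, P x <-> exists c : I -> k, x = \sum_i c i *: f i) ->
  exists N (b : 'I_N -> V), is_basis P b.
Proof.
move=> Pf.
pose S N := `[< exists b : 'I_N -> V,
  forall x, P x <-> exists c : 'I_N -> k, x = \sum_i c i *: b i >].
have exS : exists N, S N.
  exists #|I|; apply/asboolP; exists (f \o enum_val) => x; rewrite Pf.
  split=> [] [c ->].
    exists (c \o enum_val).
    by rewrite (reindex _ (onW_bij _ (enum_val_bij I))).
  exists (c \o enum_rank).
  rewrite (reindex _ (onW_bij _ (enum_rank_bij I))) /=.
  by apply: eq_bigr => i _; rewrite /= enum_rankK.
have [N /asboolP[b Pb] minN] := ex_minnP exS.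
exists N, b; split=> // c c0 i0; apply/eqP; apply/negPn/negP => ci0.
case: N => [|N] in b Pb minN c c0 i0 ci0 *; first by case: i0 ci0.
suff /minN : S N by rewrite ltnn.
apply/asboolP; exists (b \o lift i0) => x; rewrite Pb.
split=> [] [e ->].
  exists (fun j => e (lift i0 j) - e i0 / c i0 * c (lift i0 j)).
  have -> : \sum_i e i *: b i = \sum_i (e i - e i0 / c i0 * c i) *: b i.
    under [RHS]eq_bigr do rewrite scalerBl -scalerA.
    by rewrite sumrB -scaler_sumr c0 scaler0 subr0.
  by rewrite (bigD1_ord i0) //= divfK // subrr scale0r add0r.
exists (fun j => if unlift i0 j is Some j' then e j' else 0).
rewrite (bigD1_ord i0) //= unlift_none scale0r add0r.
by apply: eq_bigr => j _; rewrite liftK.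
Qed.

End Basis.

Section GradedRepresentation.
Variables (k : fieldType) (n : nat).
Local Notation A := (dihAlg k n).
Local Notation D := (dihedral n).

(* [rG] is the matrix form, in some basis, of the action of D_n on A_[d]. *)
Definition Agr_affords (d : nat) (rG : representation k D) : Prop :=
  exists2 b : 'I_(rdegree rG) -> A, is_basis (@Agr k n d) b &
    forall g, g \in D -> forall i,
      dact g (b i) = \sum_j rG g i j *: b j.

Hypothesis n_gt2 : (2 < n)%N.

Lemma Agr_affords_exists d : exists rG, Agr_affords d rG.
Proof.
have [N [b bb]] := finite_basis
  (fun x => iff_refl (exists c : d.-tuple (gens n) -> k,
                        x = \sum_t c t *: word k t)).
have [Pb bI] := bb.
have Ab i : Agr d (b i).
  apply/Pb; exists (fun j => (j == i)%:R).
  rewrite (bigD1 i) //= eqxx scale1r big1 ?addr0 // => j /negPf->.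
  by rewrite scale0r.
have uniq c e : \sum_i c i *: b i = \sum_i e i *: b i -> c =1 e.
  move/eqP; rewrite -subr_eq0 -sumrB => /eqP ce0 i; apply/eqP.
  rewrite -subr_eq0; apply/eqP/(bI (fun i => c i - e i)).
  by rewrite -[RHS]ce0; apply: eq_bigr => j _; rewrite scalerBl.
have /choice[M HM] : forall g, exists M : 'M[k]_N, g \in D ->
    forall i, dact g (b i) = \sum_j M i j *: b j.
  move=> g; have [Dg|nDg] := boolP (g \in D); last by exists 0.
  have /choice[c Hc] i : exists c : 'I_N -> k, dact g (b i) = \sum_j c j *: b j.
    by apply/Pb/Agr_act.
  exists (\matrix_(i, j) c i j) => _ i; rewrite Hc.
  by apply: eq_bigr => j _; rewrite mxE.
have reprM : mx_repr D M.
  split=> [|g h Dg Dh]; apply/matrixP=> i; apply: uniq.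
    rewrite -HM ?group1 // (dact1 n_gt2 (Ab i)) (bigD1 i) //= mxE eqxx scale1r.
    by rewrite big1 ?addr0 // => j /negPf ij; rewrite mxE eq_sym ij scale0r.
  rewrite -HM ?groupM // (dactM n_gt2 Dg Dh (Ab i)) HM // dact_sum //.
  under eq_bigr do rewrite HM // scaler_sumr.
  rewrite exchange_big; apply: eq_bigr => j _; rewrite mxE scaler_suml.
  by apply: eq_bigr => l _; rewrite scalerA.
by exists (Representation (MxRepresentation reprM)); exists b.
Qed.

Definition Agr_repr (d : nat) : representation k D :=
  sval (cid (Agr_affords_exists d)).

End GradedRepresentation.

Section Multiplicity.
Variables (k : fieldType) (gT : finGroupType) (G : {group gT}).

Lemma socleType_exists (rG : representation k G) :
  exists sG : socleType rG, True.
Proof.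
apply/asboolP; apply: (@socle_exists k gT G _ rG) => sG.
by apply/asboolP; exists sG.
Qed.

Definition the_socle (rG : representation k G) : socleType rG :=
  sval (cid (socleType_exists rG)).

(* Multiplicity of the irreducible [phi] in [rG]: the multiplicity of the     *)
(* homogeneous component of type [phi]; at most one W contributes.            *)
Definition mx_mult (phi rG : representation k G) : nat :=
  (\sum_(W : the_socle rG | `[< mx_rsim phi (socle_repr W) >]) socle_mult W)%N.

(* In non-modular characteristic the homogeneous components exhaust [rG]. *)
Lemma mx_rsim_homogeneous (rG : representation k G) :
    ([pchar k]^'.-group G)%g ->
  mx_rsim rG (\big[dadd_grepr/grepr0]_(W : the_socle rG)
     muln_grepr (Representation (socle_repr W)) (socle_mult W)).
Proof.
move=> charG; set sG := the_socle rG.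
have defS : (\sum_(W : sG) W :=: 1%:M)%MS.
  have <- // : Socle sG = 1%:M := reducible_Socle1 sG (mx_Maschke_pchar rG charG).
apply: mx_rsim_trans (mx_rsim_sym (rsim_submod1 (mxmodule1 rG) _)) _ => //.
apply: mx_rsim_dsum (fun W : sG => component_mx_module rG (socle_base W)) _ defS _ _.
  exact: Socle_direct.
by move=> W; apply: mx_rsim_socle; apply: mx_rsim_refl.
Qed.

End Multiplicity.

(* Coefficient of t^d in the formal power series 1 / (1 - q(t)), q(0) = 0. *)
Definition inv1B (q : {poly rat}) (d : nat) : rat :=
  (\sum_(j < d.+1) q ^+ j)`_d.

Lemma inv1BP (q : {poly rat}) d : q`_0 = 0 ->
  \sum_(i < d.+1) (1 - q)`_i * inv1B q (d - i) = (d == 0)%:R.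
Proof.
move=> q0.
have qX j m : (m < j)%N -> (q ^+ j)`_m = 0.
  have [p ->] : exists p, q = p * 'X.
    have /factor_theorem[p ->] : root q 0 by rewrite /root horner_coef0 q0.
    by exists p; rewrite subr0.
  by move=> mj; rewrite exprMn_comm ?coefMXn ?mj //; apply: commr_polyX.
have inv1BE m : (m <= d)%N -> inv1B q m = (\sum_(j < d.+1) q ^+ j)`_m.
  move=> md; rewrite /inv1B !coef_sum (big_ord_widen d.+1 (fun j => (q ^+ j)`_m)) //.
  rewrite big_mkcond; apply: eq_bigr => j _.
  by case: ltnP => // /qX.
transitivity (((1 - q) * \sum_(j < d.+1) q ^+ j)`_d).
  rewrite coefM; apply: eq_bigr => i _; rewrite inv1BE //; exact: leq_subr.
by rewrite -opprB mulNr -subrX1 opprB coefB coef1 qX // subr0.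
Qed.

Section Series.
Variable n : nat.

Definition ser_a : nat -> rat :=
  inv1B ((2 * n%:R + 1) *: 'X - (2 * n%:R - 1) *: 'X^2 + 'X^3).
Definition ser_b : nat -> rat := inv1B ('X + 'X^2 + 'X^3).
Definition ser_c : nat -> rat := inv1B (3 *: 'X + 'X^2 - 'X^3).

End Series.

Section GradedMultiplicity.
Variables (k : fieldType) (n : nat) (n_gt2 : (2 < n)%N).
Local Notation D := (dihedral n).
Local Notation r := (drot n).
Local Notation s := (dref n).
Implicit Type phi : representation k D.

(* Coefficient of t^d in m_phi(t). *)
Definition graded_mult phi (d : nat) : rat :=
  (mx_mult phi (Agr_repr k n_gt2 d))%:R.

(* The character of [phi] is the linear character r |-> e1, s |-> e2. *)
Definition char_lin (e1 e2 : k) phi : Prop :=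
  forall i : nat, \tr (phi (r ^+ i)%g) = e1 ^+ i /\
                  \tr (phi (r ^+ i * s)%g) = e1 ^+ i * e2.

(* The character of [phi] is chi_j: if z is a primitive n-th root of unity in *)
(* an extension L of k, playing the role of exp(2 pi i / n), then             *)
(* 2 cos(2 pi i j / n) is z^(ij) + z^(-ij).                                   *)
Definition char_two (L : fieldType) (iota : k -> L) (z : L) (j : nat) phi :
    Prop :=
  forall i : nat, iota (\tr (phi (r ^+ i)%g)) = z ^+ (i * j) + z ^- (i * j) /\
                  \tr (phi (r ^+ i * s)%g) = 0.

(* Every irreducible representation whose character satisfies [chi] has       *)
(* graded multiplicity [m].                                                   *)
Definition has_graded_mult (chi : representation k D -> Prop)
    (m : nat -> rat) : Prop :=
  forall phi, mx_irreducible phi -> chi phi -> graded_mult phi =1 m.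

End GradedMultiplicity.

Arguments has_graded_mult k {n} n_gt2 chi m.

(* Main.v *)
(* To the polygon, its edges and its vertices attach the monic polynomials    *)
(* P = t^3 - U1 t^2 + U2 t - U3, P_i = t^2 - V1_i t + V2_i and t - W_j, where *)
(* P = (t - (u - v_i)) P_i and P_i = (t - (v_i - w_j)) (t - w_j), t being     *)
(* central. The relations of A say exactly that these do not depend on the    *)
(* choices of i and of j incident to i, and they amount to the rewriting rules*)
(*   V1_i W_j -> V2_i + W_j^2,          U1 V1_i -> U2 + V1_i^2 - V2_i,        *)
(*   U1 V2_i -> U3 + V1_i V2_i,         U2 W_j -> U3 + U1 W_j^2 - W_j^3.      *)
(* This system is confluent, so the words in the letters U, V, W that contain *)
(* no left-hand side form a basis of A. As D_n permutes the letters and       *)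
(* preserves the rules, it permutes this basis, and the trace of g on A_[d]   *)
(* is the number of fixed words of weight d. Sorting these words by their     *)
(* first letter gives a linear recurrence of order 3 that depends only on the *)
(* number N of fixed edges and vertices and on the number M of fixed incident *)
(* pairs: (N, M) is (2n, 2n) for the identity, (0, 0) for the other rotations *)
(* and (2, 0) for every reflection. The multiplicities are then inner         *)
(* products of characters.                                                    *)

From HB Require Import structures.
Require Import Defs.
From mathcomp Require Import all_boot all_order all_algebra all_fingroup.
From mathcomp Require Import all_character.
From mathcomp Require Import pgroup boolp ring zify.

Set Implicit Arguments.
Unset Strict Implicit.
Unset Printing Implicit Defensive.

Import GRing.Theory.
Local Open Scope ring_scope.

(** * Multiplicities as inner products of characters *)

(** Two facts carry the proof: the normal words, those sorted by [follows], give a basis of the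
    algebra which D_n permutes, and their fixed points can be counted by first letters.

    Spanning comes from rewriting ([normal_span_gen_word], [Agr_normal_span]). For independence, the
    rewriting rules define operators on functions of words; these operators satisfy the defining
    relations ([dual_gen_rel]), so the algebra acts on functions. A normal word s turns a function p
    into one whose value at the empty word is p(s) ([dual_word]), which recovers every coefficient
    of a combination of normal words ([word_elt_free]).

    Hence the trace of g in degree d is a number of fixed words ([tr_Agr_repr]), and its series is 1
    / (1 - (1 + N) t - (1 - M) t^2 - (1 - N + M) t^3) by [nfixed_ser]. It is the same for all
    nontrivial rotations and for all reflections, so the inner product of characters
    ([mx_mult_inner]) involves only the degree of the irreducible and the sums of its character over
    these two sets ([mx_mult_dihedral]). *)

Section CharacterOrthogonality.
Variables (k : fieldType) (gT : finGroupType) (G : {group gT}).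
Hypothesis k_char0 : [pchar k] =i pred0.

Lemma pchar0_natf_neq0 m : (0 < m)%N -> m%:R != 0 :> k.
Proof. by rewrite lt0n ((pcharf0P k).1 k_char0). Qed.

(** The projection of matrices onto the intertwining ones. *)
Definition averaged n1 n2 (rG1 : mx_representation k G n1)
    (rG2 : mx_representation k G n2) (M : 'M[k]_(n1, n2)) : 'M[k]_(n1, n2) :=
  #|G|%:R^-1 *: \sum_(g in G) rG1 g^-1%g *m M *m rG2 g.

Lemma averaged_intertwine n1 n2 (rG1 : mx_representation k G n1)
    (rG2 : mx_representation k G n2) M g : g \in G ->
  rG1 g *m averaged rG1 rG2 M = averaged rG1 rG2 M *m rG2 g.
Proof.
move=> Gg; rewrite -scalemxAr -scalemxAl; congr (_ *: _).
rewrite mulmx_sumr mulmx_suml (reindex_acts 'R _ Gg) ?astabsR //=.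
apply: eq_bigr => h Gh; rewrite !mulmxA -repr_mxM ?groupV ?groupM //.
by rewrite invMg mulKVg repr_mxM // !mulmxA.
Qed.

(** Schur's lemma: the kernel and the image of f are submodules, so f is bijective as soon as it is
    nonzero. *)
Lemma intertwine_irr_rsim n1 n2 (rG1 : mx_representation k G n1)
    (rG2 : mx_representation k G n2) (f : 'M[k]_(n1, n2)) :
    mx_irreducible rG1 -> mx_irreducible rG2 ->
    (forall g, g \in G -> rG1 g *m f = f *m rG2 g) -> f != 0 ->
  mx_rsim rG1 rG2.
Proof.
move=> /mx_irrP[_ irr1] /mx_irrP[_ irr2] fG f0.
have f_free : row_free f.
  rewrite -kermx_eq0; apply: contraNT f0 => ker_f.
  have /irr1/(_ ker_f) : mxmodule rG1 (kermx f).
    apply/mxmoduleP => g Gg; apply/sub_kermxP.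
    by rewrite -mulmxA fG // mulmxA mulmx_ker mul0mx.
  by rewrite -sub1mx => /sub_kermxP; rewrite mul1mx => ->.
have f_full : row_full f.
  have mod_f : mxmodule rG2 <<f>>%MS.
    apply/mxmoduleP => g Gg; rewrite (eqmxMr _ (genmxE f)) genmxE -fG //.
    exact: submxMl.
  have := irr2 _ mod_f; rewrite -!sub1mx genmxE; apply.
  by rewrite -submx0 genmxE submx0.
by exists f => //; rewrite -(eqP f_free) (eqP f_full).
Qed.

Lemma mul_mx_delta_mx m n p q (A : 'M[k]_(m, n)) (B : 'M[k]_(p, q)) i j a b :
  (A *m delta_mx i j *m B) a b = A a i * B j b.
Proof.
rewrite -(mul_delta_mx (0 : 'I_1)) mulmxA -mulmxA -colE -rowE.
by rewrite mxE big_ord1 !mxE.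
Qed.

(** Both sides are the trace of the linear map [averaged] on matrices: M |-> A M B has trace tr A *
    tr B, and the right side reads the trace off on matrix units. *)
Lemma sum_tr_averaged n1 n2 (rG1 : mx_representation k G n1)
    (rG2 : mx_representation k G n2) :
  #|G|%:R^-1 * (\sum_(g in G) \tr (rG1 g^-1%g) * \tr (rG2 g))
    = \sum_i \sum_j averaged rG1 rG2 (delta_mx i j) i j.
Proof.
transitivity (#|G|%:R^-1 * (\sum_i \sum_j \sum_(g in G) rG1 g^-1%g i i * rG2 g j j)).
  congr (_ * _); under [RHS]eq_bigr do rewrite exchange_big.
  rewrite exchange_big; apply: eq_bigr => g _.
  by rewrite mulr_suml; apply: eq_bigr => i _; rewrite mulr_sumr.
rewrite mulr_sumr; apply: eq_bigr => i _.
rewrite mulr_sumr; apply: eq_bigr => j _.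
rewrite mxE summxE; congr (_ * _); apply: eq_bigr => g _.
by rewrite mul_mx_delta_mx.
Qed.

(** First orthogonality relation. Averages intertwine, so they vanish when the representations are
    not similar; otherwise the second may be replaced by the first, and absolute irreducibility
    makes the averages scalar. *)
Lemma abs_irr_inner n1 n2 (rG1 : mx_representation k G n1)
    (rG2 : mx_representation k G n2) :
    mx_absolutely_irreducible rG1 -> mx_irreducible rG2 ->
  #|G|%:R^-1 * (\sum_(g in G) \tr (rG1 g^-1%g) * \tr (rG2 g))
    = `[< mx_rsim rG1 rG2 >]%:R.
Proof.
move=> absG1 irr2; have irr1 := mx_abs_irrW absG1.
case: asboolP => [sim12 | nsim12]; last first.
  rewrite sum_tr_averaged big1 // => i _; rewrite big1 // => j _.
  have [->|nz] := eqVneq (averaged rG1 rG2 (delta_mx i j)) 0.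
    by rewrite mxE.
  case: nsim12; apply: intertwine_irr_rsim irr1 irr2 _ nz => g Gg.
  exact: averaged_intertwine.
under eq_bigr => g Gg do rewrite -(mxtrace_rsim sim12 Gg).
rewrite sum_tr_averaged.
have n1_gt0 : (0 < n1)%N by case/mx_irrP: irr1.
have nz_n1 := pchar0_natf_neq0 n1_gt0.
have avg_delta i j : averaged rG1 rG1 (delta_mx i j) = ((i == j)%:R / n1%:R)%:M.
  have /mx_abs_irr_cent_scalar cent := absG1.
  have /is_scalar_mxP[c defc] : is_scalar_mx (averaged rG1 rG1 (delta_mx i j)).
    by apply: cent; apply/centgmxP => g Gg; apply/esym/averaged_intertwine.
  (* Averaging by conjugation preserves the trace, which determines the scalar. *)
  rewrite defc; congr _%:M; apply: (mulIf nz_n1); rewrite divfK //.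
  have := congr1 mxtrace defc; rewrite mxtrace_scalar mulr_natr => <-.
  rewrite mxtraceZ raddf_sum /=.
  under eq_bigr => g Gg.
    rewrite mxtrace_mulC mulmxA -repr_mxM ?groupV // mulgV repr_mx1 mul1mx.
    over.
  rewrite sumr_const -[\tr _ *+ _]mulr_natl mulKf ?pchar0_natf_neq0 //.
  rewrite /mxtrace (bigD1 i) //= big1 => [|a /negPf ai].
    by rewrite mxE eqxx addr0.
  by rewrite mxE ai.
under eq_bigr => i _.
  rewrite (bigD1 i) //= big1 => [|j /negPf ij].
    rewrite avg_delta !mxE !eqxx addr0 mulr1n div1r.
  over.
  by rewrite avg_delta eq_sym ij mul0r !mxE mul0rn.
by rewrite sumr_const card_ord -[_^-1 *+ _]mulr_natr mulVf.
Qed.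

(** By Maschke's theorem the trace of rG is the sum over its socle components, and orthogonality
    with phi keeps only those of type phi. *)
Lemma mx_mult_inner (phi rG : representation k G) :
    mx_absolutely_irreducible phi ->
  (mx_mult phi rG)%:R
    = #|G|%:R^-1 * (\sum_(g in G) \tr (phi g^-1%g) * \tr (rG g)).
Proof.
move=> abs_phi; pose sG := the_socle rG.
have charG : ([pchar k]^'.-group G)%g.
  by apply/pnatP => // p _ _; rewrite inE /= k_char0.
have soc1 : (Socle sG :=: 1%:M)%MS.
  have -> // : Socle sG = 1%:M by apply: reducible_Socle1; apply: mx_Maschke_pchar.
have trE g : g \in G ->
    \tr (rG g) = \sum_(W : sG) \tr (socle_repr W g) *+ socle_mult W.
  by move=> Gg; rewrite -(mxtrace_submod1 (Socle_module sG) soc1 Gg) mxtrace_Socle.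
transitivity (\sum_(W : sG) (#|G|%:R^-1 *
    (\sum_(g in G) \tr (phi g^-1%g) * \tr (socle_repr W g))) *+ socle_mult W).
  rewrite natr_sum big_mkcond; apply: eq_bigr => W _.
  rewrite abs_irr_inner //; last exact: socle_irr.
  by case: asboolP => _; rewrite ?mul0rn.
under eq_bigr do rewrite -mulrnAr -sumrMnl.
rewrite -mulr_sumr exchange_big; congr (_ * _).
apply: eq_bigr => g Gg; rewrite trE // mulr_sumr.
by apply: eq_bigr => W _; rewrite mulrnAr.
Qed.

End CharacterOrthogonality.

(** The matrix M may come from an unspecified basis b. With C and D the coordinate changes between b
    and f, one has M = C S D, where S is the matrix of sigma, so tr M = tr (S D C) = tr S. *)
Lemma mxtrace_permuted_basis (k : fieldType) (V : lmodType k) (P : V -> Prop)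
    (phi : {linear V -> V}) N (b : 'I_N -> V) (M : 'M[k]_N) (I : finType)
    (f : I -> V) (sigma : I -> I) :
    is_basis P b ->
    (forall i, phi (b i) = \sum_j M i j *: b j) ->
    (forall x, P x <-> exists c : I -> k, x = \sum_i c i *: f i) ->
    (forall c : I -> k, \sum_i c i *: f i = 0 -> forall i, c i = 0) ->
    (forall i, phi (f i) = f (sigma i)) ->
  \tr M = (\sum_i (sigma i == i))%:R.
Proof.
move=> [Pb b_free] phi_b Pf f_free phi_f.
have b_inj c e : \sum_i c i *: b i = \sum_i e i *: b i -> c =1 e.
  move/eqP; rewrite -subr_eq0 -sumrB => /eqP ce0 i; apply/eqP.
  rewrite -subr_eq0; apply/eqP/(b_free (fun i => c i - e i)).
  by rewrite -[RHS]ce0; apply: eq_bigr => j _; rewrite scalerBl.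
have f_inj c e : \sum_i c i *: f i = \sum_i e i *: f i -> c =1 e.
  move/eqP; rewrite -subr_eq0 -sumrB => /eqP ce0 i; apply/eqP.
  rewrite -subr_eq0; apply/eqP/(f_free (fun i => c i - e i)).
  by rewrite -[RHS]ce0; apply: eq_bigr => j _; rewrite scalerBl.
have /choice[C bE] i : exists c : I -> k, b i = \sum_x c x *: f x.
  apply/Pf/Pb; exists (fun j => (j == i)%:R).
  rewrite (bigD1 i) //= eqxx scale1r big1 ?addr0 // => j /negPf->.
  by rewrite scale0r.
have /choice[D fE] x : exists c : 'I_N -> k, f x = \sum_i c i *: b i.
  apply/Pb/Pf; exists (fun y => (y == x)%:R).
  rewrite (bigD1 x) //= eqxx scale1r big1 ?addr0 // => y /negPf->.
  by rewrite scale0r.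
have DC x y : \sum_i D x i * C i y = (x == y)%:R.
  apply/esym; move: y; apply: f_inj.
  transitivity (f x).
    rewrite (bigD1 x) //= eqxx scale1r big1 ?addr0 // => y /negPf xy.
    by rewrite eq_sym xy scale0r.
  rewrite fE; under eq_bigr do rewrite bE scaler_sumr.
  rewrite exchange_big; apply: eq_bigr => y _; rewrite scaler_suml.
  by apply: eq_bigr => i _; rewrite scalerA.
have ME i j : M i j = \sum_x C i x * D (sigma x) j.
  move: j; apply: b_inj; rewrite -phi_b bE linear_sum.
  under eq_bigr do rewrite linearZ /= phi_f fE scaler_sumr.
  rewrite exchange_big; apply: eq_bigr => j _; rewrite scaler_suml.
  by apply: eq_bigr => x _; rewrite scalerA.
transitivity (\sum_i \sum_x C i x * D (sigma x) i).
  by apply: eq_bigr => i _; apply: ME.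
rewrite exchange_big natr_sum; apply: eq_bigr => x _.
by rewrite -DC; apply: eq_bigr => i _; rewrite mulrC.
Qed.

(** * The algebra of operators on functions of words *)

Section RightOperators.
Variables (k : fieldType) (X : Type).
Local Notation fn := (seq X -> k).

(* The product is composition in the reverse order, because a left action on  *)
(* words dualizes to a right action on functions of words.                    *)
Record rop := Rop {
  rfun :> fn -> fn;
  rfunP : forall c (p q : fn) s,
    rfun (fun t => c * p t + q t) s = c * rfun p s + rfun q s }.

HB.instance Definition _ := gen_eqMixin rop.
HB.instance Definition _ := gen_choiceMixin rop.

Lemma rop_ext (a b : rop) : (forall p s, a p s = b p s) -> a = b.
Proof.
case: a b => [a aP] [b bP] /= ab.
have {}ab : a = b by apply/funext => p; apply/funext.
by case: _ / ab in bP *; congr Rop; apply: Prop_irrelevance.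
Qed.

Fact rop0P c (p q : fn) (s : seq X) : 0 = c * 0 + 0 :> k.
Proof. by rewrite mulr0 addr0. Qed.
Definition rop0 := @Rop (fun _ _ => 0) rop0P.

Fact ropDP (a b : rop) c (p q : fn) s : let f p s := a p s + b p s in
  f (fun t => c * p t + q t) s = c * f p s + f q s.
Proof. by rewrite /= !rfunP mulrDr addrACA. Qed.
Definition ropD a b := @Rop _ (@ropDP a b).

Fact ropZP (d : k) (a : rop) c (p q : fn) s : let f p s := d * a p s in
  f (fun t => c * p t + q t) s = c * f p s + f q s.
Proof. by rewrite /= rfunP mulrDr mulrCA. Qed.
Definition ropZ d a := @Rop _ (@ropZP d a).

Fact ropMP (a b : rop) c (p q : fn) s : let f p s := b (a p) s in
  f (fun t => c * p t + q t) s = c * f p s + f q s.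
Proof.
by rewrite /= -rfunP; congr (b _ s); apply/funext => t; rewrite rfunP.
Qed.
Definition ropM a b := @Rop _ (@ropMP a b).

Definition rop1 := @Rop (fun p => p) (fun _ _ _ _ => erefl).

Fact ropDA : associative ropD.
Proof. by move=> a b c; apply: rop_ext => p s /=; rewrite addrA. Qed.
Fact ropDC : commutative ropD.
Proof. by move=> a b; apply: rop_ext => p s /=; rewrite addrC. Qed.
Fact rop0D : left_id rop0 ropD.
Proof. by move=> a; apply: rop_ext => p s /=; rewrite add0r. Qed.
Fact ropND : left_inverse rop0 (ropZ (-1)) ropD.
Proof. by move=> a; apply: rop_ext => p s /=; rewrite mulN1r addNr. Qed.
HB.instance Definition _ := GRing.isZmodule.Build rop ropDA ropDC rop0D ropND.

Fact ropMA : associative ropM. Proof. by move=> a b c; apply: rop_ext. Qed.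
Fact rop1M : left_id rop1 ropM. Proof. by move=> a; apply: rop_ext. Qed.
Fact ropM1 : right_id rop1 ropM. Proof. by move=> a; apply: rop_ext. Qed.
Fact ropMDl : left_distributive ropM ropD.
Proof.
move=> a b c; apply: rop_ext => p s /=; rewrite -[c (a p) s]mul1r -rfunP.
by congr (c _ s); apply/funext => t; rewrite mul1r.
Qed.
Fact ropMDr : right_distributive ropM ropD.
Proof. by move=> a b c; apply: rop_ext. Qed.
Fact rop1_neq0 : rop1 != 0.
Proof.
apply/eqP => /(congr1 (fun a : rop => a (fun=> 1) [::])) /= /eqP.
by rewrite oner_eq0.
Qed.
HB.instance Definition _ :=
  GRing.Zmodule_isNzRing.Build rop ropMA rop1M ropM1 ropMDl ropMDr rop1_neq0.

Fact ropZA c d a : ropZ c (ropZ d a) = ropZ (c * d) a.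
Proof. by apply: rop_ext => p s /=; rewrite mulrA. Qed.
Fact rop1Z : left_id 1 ropZ.
Proof. by move=> a; apply: rop_ext => p s /=; rewrite mul1r. Qed.
Fact ropZDr : right_distributive ropZ +%R.
Proof. by move=> c a b; apply: rop_ext => p s /=; rewrite mulrDr. Qed.
Fact ropZDl a : {morph ropZ^~ a : c d / c + d}.
Proof. by move=> c d; apply: rop_ext => p s /=; rewrite mulrDl. Qed.
HB.instance Definition _ :=
  GRing.Zmodule_isLmodule.Build k rop ropZA rop1Z ropZDr ropZDl.

Fact ropZAl c (a b : rop) : c *: (a * b) = (c *: a) * b.
Proof.
apply: rop_ext => p s /=.
have b0 : b (fun=> 0) s = 0.
  rewrite -[RHS](addNr (b (fun=> 0) s)) -mulN1r -rfunP.
  by congr (b _ s); apply/funext => t; rewrite mulr0 addr0.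
rewrite -[LHS]addr0 -b0 -rfunP; congr (b _ s).
by apply/funext => t; rewrite addr0.
Qed.
HB.instance Definition _ := GRing.Lmodule_isLalgebra.Build k rop ropZAl.

Fact ropZAr c (a b : rop) : c *: (a * b) = a * (c *: b).
Proof. by apply: rop_ext. Qed.
HB.instance Definition _ := GRing.Lalgebra_isAlgebra.Build k rop ropZAr.

Lemma ropDE (a b : rop) p s : (a + b) p s = a p s + b p s. Proof. by []. Qed.
Lemma ropNE (a : rop) p s : (- a) p s = - a p s. Proof. exact: mulN1r. Qed.
Lemma ropME (a b : rop) p s : (a * b) p s = b (a p) s. Proof. by []. Qed.

End RightOperators.

(** * Letters and rewriting rules *)

Section Letters.
Variable n : nat.

Inductive letter := U1 | U2 | U3 | V1 of 'Z_n | V2 of 'Z_n | W of 'Z_n.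

Definition letter_enc (x : letter) : ('I_3 + ('Z_n + 'Z_n)) + 'Z_n :=
  match x with
  | U1 => inl (inl 0) | U2 => inl (inl 1) | U3 => inl (inl (1 + 1))
  | V1 i => inl (inr (inl i)) | V2 i => inl (inr (inr i)) | W i => inr i
  end.
Definition letter_dec (x : ('I_3 + ('Z_n + 'Z_n)) + 'Z_n) : letter :=
  match x with
  | inl (inl i) => if i == 0 then U1 else if i == 1 then U2 else U3
  | inl (inr (inl i)) => V1 i | inl (inr (inr i)) => V2 i | inr i => W i
  end.

Lemma letter_encK : cancel letter_enc letter_dec. Proof. by case. Qed.
Lemma letter_decK : cancel letter_dec letter_enc.
Proof.
by case=> [[[[|[|[|i]]] lt_i3]|[]]|] //=; congr (inl (inl _)); apply/val_inj.
Qed.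

HB.instance Definition _ := Countable.copy letter (can_type letter_encK).
HB.instance Definition _ : isFinite letter := CanIsFinite letter_encK.

Lemma sum_letter (R : nmodType) (F : letter -> R) :
  \sum_x F x = F U1 + F U2 + F U3 + (\sum_i F (V1 i) + \sum_i F (V2 i))
               + \sum_i F (W i).
Proof.
rewrite (reindex letter_dec) /=; last first.
  by exists letter_enc => x _; rewrite ?letter_encK ?letter_decK.
rewrite !big_sumType /=; congr (_ + _ + _).
by rewrite !big_ord_recl big_ord0 /= addr0 addrA.
Qed.

Definition wt (x : letter) : nat :=
  match x with U1 | V1 _ | W _ => 1 | U2 | V2 _ => 2 | U3 => 3 end.
Definition wts (s : seq letter) : nat := sumn (map wt s).

(* The vertex j lies on the edge {i, i + 1}. *)
Definition incident (i j : 'Z_n) : bool := (j == i) || (j == i + 1).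

Definition follows (x y : letter) : bool :=
  match x, y with
  | U1, (V1 _ | V2 _) | U2, W _ => false
  | V1 i, W j => ~~ incident i j
  | _, _ => true
  end.

(* [opX p s] is the value of [p], extended linearly, at the result of         *)
(* rewriting the word obtained by putting the letter X in front of [s].       *)
Section Operators.
Variables (V : zmodType) (p : seq letter -> V).

Definition opW j s := p (W j :: s).
Definition opV i s :=
  match s with
  | W j :: s' => if incident i j then p (V2 i :: s') + p [:: W j, W j & s']
                 else p (V1 i :: s)
  | _ => p (V1 i :: s)
  end.
Definition opU2 s :=
  match s with
  | W j :: s' => p (U3 :: s') + p [:: U1, W j, W j & s']
                 - p [:: W j, W j, W j & s']
  | _ => p (U2 :: s)
  end.
Definition opU s :=
  match s with
  | V1 i :: s' => opU2 s' + p [:: V1 i, V1 i & s'] - p (V2 i :: s')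
  | V2 i :: s' => p (U3 :: s') + p [:: V1 i, V2 i & s']
  | _ => p (U1 :: s)
  end.
End Operators.

End Letters.
Arguments U1 {n}.
Arguments U2 {n}.
Arguments U3 {n}.

Lemma Zn_ind n (P : 'Z_n -> Prop) :
  P 0 -> (forall i, P i -> P (i + 1)) -> forall i, P i.
Proof.
move=> P0 PS i; rewrite -[i]natr_Zp.
by elim: (i : nat) => [|m IHm] //; rewrite -addn1 natrD; apply: PS.
Qed.

(** * The rewriting rules as consequences of the defining relations *)

Section Straightening.
Variables (n : nat) (R : nzRingType) (g : gens n -> R).
Hypothesis g_rel : forall j, drel g j = 0.
Local Notation u := (g None).
Local Notation v i := (g (Some (inl i))).
Local Notation w i := (g (Some (inr i))).

(** [V2elt], [U2elt] and [U3elt] are the lower coefficients of the polynomials P_i and P, computed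
    with the vertex j = i and with the edge 0; independence of these choices is proved below. *)
Definition V2elt i : R := (v i - w i) * w i.
Definition U2elt : R := (u - v 0) * v 0 + V2elt 0.
Definition U3elt : R := (u - v 0) * V2elt 0.

(** The first family of relations says that (v_i - w_j) w_j agrees for the two ends j of the edge
    i. *)
Lemma mul_v_w i j : incident i j -> v i * w j = V2elt i + w j * w j.
Proof.
case/orP=> /eqP->; first by rewrite /V2elt mulrBl subrK.
have := g_rel (inl i : 'Z_n + 'Z_n); rewrite /drel mulrBr.
rewrite (addrAC (v i * w i)) (addrAC (v i * w i - _)) => /eqP.
rewrite subr_eq0 => /eqP <-.
by rewrite /V2elt mulrBl.
Qed.

Lemma V2elt_inc i j : incident i j -> V2elt i = (v i - w j) * w j.
Proof. by move=> ij; rewrite mulrBl mul_v_w // addrK. Qed.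

Lemma incidentS (i : 'Z_n) : incident i (i + 1).
Proof. by rewrite /incident eqxx orbT. Qed.

Lemma incident_refl (i : 'Z_n) : incident i i.
Proof. by rewrite /incident eqxx. Qed.

(** Going around the polygon: with [V2elt] computed at the common vertex i + 1, the difference of
    the values at the edges i and i + 1 is a relation of the second family. *)
Lemma U2eltE i : (u - v i) * v i + V2elt i = U2elt.
Proof.
elim/Zn_ind: i => // i <-.
have := g_rel (inr i : 'Z_n + 'Z_n); rewrite /drel => rel.
apply/esym/eqP; rewrite -subr_eq0 -[X in _ == X]rel; apply/eqP.
rewrite (V2elt_inc (incidentS i)) (V2elt_inc (incident_refl _)).
rewrite opprD addrACA -mulrBl.
rewrite (opprB (v (i + 1)) (w (i + 1))) addrA subrK; congr (_ + _).
by rewrite !mulrBl mulrBr opprB addrA addrAC (addrAC (u * v i)).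
Qed.

Lemma mul_uv_vw i j : incident i j ->
  (u - v i) * (v i - w j) = U2elt + w j * w j - u * w j.
Proof.
move=> ij; rewrite mulrBr (mulrBl (w j)) mul_v_w //.
have -> : (u - v i) * v i = U2elt - V2elt i by rewrite -(U2eltE i) addrK.
by rewrite opprB addrA addrA subrK.
Qed.

(** No new relation is required: by [mul_uv_vw] the product (u - v_i)(v_i - w_j) depends only on the
    vertex j, and consecutive edges share a vertex. *)
Lemma U3eltE i : (u - v i) * V2elt i = U3elt.
Proof.
elim/Zn_ind: i => // i <-.
rewrite (V2elt_inc (incidentS i)) (V2elt_inc (incident_refl (i + 1))) !mulrA.
by rewrite !mul_uv_vw ?incidentS ?incident_refl.
Qed.

Lemma mul_u_v i : u * v i = U2elt + v i * v i - V2elt i.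
Proof. by rewrite -(U2eltE i) mulrBl addrAC addrK subrK. Qed.

Lemma mul_u_V2 i : u * V2elt i = U3elt + v i * V2elt i.
Proof. by rewrite -(U3eltE i) mulrBl subrK. Qed.

Lemma mul_U2_w j : U2elt * w j = U3elt + u * w j * w j - w j * w j * w j.
Proof.
rewrite -(U3eltE j) /V2elt mulrA mul_uv_vw ?incident_refl //.
by rewrite (mulrBl (w j) (_ + _)) (mulrDl U2elt) subrK addrK.
Qed.

Definition letter_elt (x : letter n) : R :=
  match x with
  | U1 => u | U2 => U2elt | U3 => U3elt
  | V1 i => v i | V2 i => V2elt i | W i => w i
  end.

Definition word_elt (s : seq (letter n)) : R := \prod_(x <- s) letter_elt x.

Lemma word_elt_cons x s : word_elt (x :: s) = letter_elt x * word_elt s.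
Proof. exact: big_cons. Qed.

Lemma mul_w_word j s : w j * word_elt s = opW word_elt j s.
Proof. by rewrite /opW word_elt_cons. Qed.

Lemma mul_v_word i s : v i * word_elt s = opV word_elt i s.
Proof.
case: s => [|[|||i0|i0|j] s] //=; rewrite ?word_elt_cons //=.
have [ij|nij] // := boolP (incident i j).
by rewrite !mulrA mul_v_w // mulrDl.
Qed.

Lemma mul_U2_word s : U2elt * word_elt s = opU2 word_elt s.
Proof.
case: s => [|[|||i0|i0|j] s] //=; rewrite !word_elt_cons //=.
by rewrite !mulrA mul_U2_w !(mulrBl, mulrDl).
Qed.

(** After U1 V1_i is rewritten, the letter U2 may stand before some W_j; hence [opU2] inside
    [opU]. *)
Lemma mul_u_word s : u * word_elt s = opU word_elt s.
Proof.
case: s => [|[|||i|i|j] s] //=; rewrite ?word_elt_cons //=.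
  by rewrite -mul_U2_word ?word_elt_cons /= !mulrA mul_u_v !(mulrBl, mulrDl).
by rewrite mulrA mul_u_V2 mulrDl -(mulrA (v i)).
Qed.

End Straightening.

(** * The dual action on functions of words *)

Section DualAction.
Variables (n : nat) (k : fieldType).
Local Notation fn := (seq (letter n) -> k).

Fact opW_linear i c (p q : fn) s :
  opW (fun t => c * p t + q t) i s = c * opW p i s + opW q i s.
Proof. by []. Qed.

Fact opV_linear i c (p q : fn) s :
  opV (fun t => c * p t + q t) i s = c * opV p i s + opV q i s.
Proof.
by case: s => [|[|||i0|i0|j] s] //=; case: ifP; rewrite // mulrDr addrACA.
Qed.

Fact opU2_linear c (p q : fn) s :
  opU2 (fun t => c * p t + q t) s = c * opU2 p s + opU2 q s.
Proof.
case: s => [|[|||i0|i0|j] s] //=.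
by ring.
Qed.

Fact opU_linear c (p q : fn) s :
  opU (fun t => c * p t + q t) s = c * opU p s + opU q s.
Proof. by case: s => [|[|||i|i|j] s] //=; rewrite ?opU2_linear; ring. Qed.

Definition dual_gen (x : gens n) : rop k (letter n) :=
  match x with
  | None => Rop opU_linear
  | Some (inl i) => Rop (opV_linear i)
  | Some (inr i) => Rop (opW_linear i)
  end.

(** This replaces the confluence check: the operators read off from the rules satisfy the relations
    on every word, normal or not. In the second family, incidence matters only for words that begin
    with some W_j. *)
Lemma dual_gen_rel j : drel dual_gen j = 0.
Proof.
apply: rop_ext => p s; case: j => i; rewrite /drel !expr2 !(ropDE, ropNE, ropME) /=.
  by rewrite /opW /= !incidentS !incident_refl /=; ring.
case: s => [|[||| j| j| j] s] /=; rewrite /opW /= ?incidentS ?incident_refl /=.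
1-6: by ring.
by case: (incident i j); case: (incident (i + 1) j); ring.
Qed.

(** When x may precede s no rule applies at the front, so x acts by plain prefixing, although U2, U3
    and V2 are defined as polynomials in the generators. *)
Lemma dual_letter x p s :
  path (@follows n) x s -> letter_elt dual_gen x p s = p (x :: s).
Proof.
case: x => [|||i|i|i]; rewrite /= /U3elt /U2elt /V2elt.
- by case: s => [|[||| j| j| j] s].
- by rewrite /opW; case: s => [|[||| j| j| j] s] //= _; rewrite ?incident_refl; ring.
- by rewrite /opW /= ?incident_refl => _; ring.
- by case: s => [|[||| j| j| j] s] //= /andP[/negPf->].
- by rewrite /opW /= incident_refl => _; ring.
by [].
Qed.

Lemma dual_word s p :
  sorted (@follows n) s -> word_elt dual_gen s p [::] = p s.
Proof.
elim: s p => [|x s IHs] p /=; first by rewrite /word_elt big_nil.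
move=> xs; rewrite word_elt_cons ropME IHs ?dual_letter //.
exact: path_sorted xs.
Qed.

End DualAction.

Lemma letter_elt_morph n (R S : nzRingType) (F : {rmorphism R -> S})
  (g : gens n -> R) x : F (letter_elt g x) = letter_elt (F \o g) x.
Proof.
by case: x => [|||i|i|i]; rewrite /= /U3elt /U2elt /V2elt
  ?(rmorphD, rmorphN, rmorphM).
Qed.

Lemma word_elt_morph n (R S : nzRingType) (F : {rmorphism R -> S})
  (g : gens n -> R) s : F (word_elt g s) = word_elt (F \o g) s.
Proof. by rewrite rmorph_prod; apply: eq_bigr => x _; apply: letter_elt_morph. Qed.

Lemma eq_letter_elt n (R : nzRingType) (g h : gens n -> R) :
  g =1 h -> letter_elt g =1 letter_elt h.
Proof.
by move=> gh [|||i|i|i]; rewrite /= /U3elt /U2elt /V2elt !gh.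
Qed.

Section Freeness.
Variables (k : fieldType) (n : nat).
Local Notation A := (dihAlg k n).

Definition dual_rep (a : A) : rop k (letter n) := dlift (@dual_gen n k) a.

HB.instance Definition _ := GRing.isLinear.Build k A (rop k (letter n)) _
  dual_rep (dlift_linear (@dual_gen_rel n k)).
HB.instance Definition _ := GRing.isMonoidMorphism.Build A (rop k (letter n))
  dual_rep (dlift_monoid (@dual_gen_rel n k)).

Lemma dual_rep_word s : dual_rep (word_elt (@dgen k n) s) = word_elt (@dual_gen n k) s.
Proof.
rewrite word_elt_morph; apply: eq_bigr => x _; apply: eq_letter_elt => y /=.
exact: dlift_gen (@dual_gen_rel n k) y.
Qed.

(** Acting on the indicator function of the word f i and evaluating at the empty word gives a linear
    functional that extracts c i. *)
Lemma word_elt_free (I : finType) (f : I -> seq (letter n)) (c : I -> k) :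
    injective f -> (forall i, sorted (@follows n) (f i)) ->
  \sum_i c i *: word_elt (@dgen k n) (f i) = 0 -> forall i, c i = 0.
Proof.
move=> f_inj f_sorted c0 i.
pose p s : k := (s == f i)%:R.
pose ev (a : rop k (letter n)) := a p [::].
have ev0 : ev 0 = 0 by [].
have evD : {morph ev : a b / a + b} by [].
have evZ a s : sorted (@follows n) s ->
    ev (dual_rep (a *: word_elt (@dgen k n) s)) = a * p s.
  by move=> sS; rewrite linearZ -dual_word // -dual_rep_word.
have ev_c0 : ev (dual_rep (\sum_i c i *: word_elt (@dgen k n) (f i))) = 0.
  by rewrite c0 linear0.
rewrite -[RHS]ev_c0 linear_sum (big_morph ev evD ev0).
rewrite (bigD1 i) //= evZ // /p eqxx mulr1 big1 ?addr0 // => j ji.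
by rewrite evZ // /p inj_eq // (negPf ji) mulr0.
Qed.

End Freeness.

(** * The basis of normal words *)

Section NormalWords.
Variable n : nat.
Implicit Types (s : seq (letter n)) (d : nat).

(** Since every letter has positive weight, this finite list contains all words of weight at most
    d. *)
Fixpoint bounded_words d : seq (seq (letter n)) :=
  if d is d'.+1 then
    [::] :: [seq x :: s | x <- enum {: letter n}, s <- bounded_words d']
  else [:: [::]].

Lemma mem_bounded_words d s : (s \in bounded_words d) = (size s <= d)%N.
Proof.
elim: d s => [|d IHd] [|x s] //=; rewrite in_cons /= ltnS -IHd.
apply/allpairsP/idP => [[[y t] /= [_ t_in [_ ->]]] //|s_in].
by exists (x, s); rewrite mem_enum.
Qed.

Lemma bounded_words_uniq d : uniq (bounded_words d).
Proof.
elim: d => [|d IHd] //=; apply/andP; split; first by apply/allpairsP=> -[[]] ? ? [].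
apply: allpairs_uniq => //; first exact: enum_uniq.
by move=> [x s] [y t] _ _ [-> ->].
Qed.

Lemma wt_gt0 (x : letter n) : (0 < wt x)%N. Proof. by case: x. Qed.

Lemma wts_cons x s : wts (x :: s) = (wt x + wts s)%N. Proof. by []. Qed.

Lemma size_wts s : (size s <= wts s)%N.
Proof.
by elim: s => //= x s IHs; rewrite -add1n leq_add // wt_gt0.
Qed.

Definition normal_words d : seq (seq (letter n)) :=
  [seq s <- bounded_words d | sorted (@follows n) s && (wts s == d)].

Lemma mem_normal_words d s :
  (s \in normal_words d) = sorted (@follows n) s && (wts s == d).
Proof.
rewrite mem_filter mem_bounded_words andb_idr // => /andP[_ /eqP <-].
exact: size_wts.
Qed.

Lemma normal_words_uniq d : uniq (normal_words d).
Proof. exact/filter_uniq/bounded_words_uniq. Qed.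

Lemma sum_seq_sub (T : choiceType) (r : seq T) (F : T -> nat) : uniq r ->
  (\sum_(x : seq_sub r) F (val x) = \sum_(x <- r) F x)%N.
Proof.
move=> r_uniq; rewrite -(big_map val xpredT F).
apply/perm_big/uniq_perm => //.
  by rewrite map_inj_uniq ?index_enum_uniq //; apply: val_inj.
move=> x; apply/mapP/idP => [[y _ ->]|x_r]; first exact: valP.
by exists (SeqSub x_r); rewrite ?mem_index_enum.
Qed.

Lemma path_follows (x : letter n) s : (forall y, follows x y) ->
  path (@follows n) x s = sorted (@follows n) s.
Proof. by case: s => //= y s ->. Qed.

End NormalWords.

Section GradedBasis.
Variables (k : fieldType) (n : nat).
Local Notation A := (dihAlg k n).
Local Notation gen := (@dgen k n).
Implicit Types (d e : nat) (x y : A).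

Lemma Agr_word s : Agr (size s) (word k s : A).
Proof.
exists (fun t => (t == in_tuple s)%:R).
rewrite (bigD1 (in_tuple s)) //= eqxx scale1r big1 ?addr0 // => t /negPf->.
by rewrite scale0r.
Qed.

Lemma Agr0 d : Agr d (0 : A).
Proof. by exists (fun=> 0); rewrite big1 // => t _; rewrite scale0r. Qed.

Lemma AgrD d x y : Agr d x -> Agr d y -> Agr d (x + y).
Proof.
move=> [c ->] [e ->]; exists (fun t => c t + e t).
by rewrite -big_split; apply: eq_bigr => t _; rewrite scalerDl.
Qed.

Lemma AgrZ d c x : Agr d x -> Agr d (c *: x).
Proof.
move=> [e ->]; exists (fun t => c * e t).
by rewrite scaler_sumr; apply: eq_bigr => t _; rewrite scalerA.
Qed.

Lemma AgrB d x y : Agr d x -> Agr d y -> Agr d (x - y).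
Proof. by move=> Ax Ay; rewrite -scaleN1r; apply/AgrD/AgrZ. Qed.

Lemma Agr_sum d (I : finType) (F : I -> A) :
  (forall i, Agr d (F i)) -> Agr d (\sum_i F i).
Proof. by move=> AF; apply: big_ind => //; [apply: Agr0 | apply: AgrD]. Qed.

Lemma AgrM d e x y : Agr d x -> Agr e y -> Agr (d + e) (x * y).
Proof.
move=> [c ->] [c' ->]; rewrite mulr_suml; apply: Agr_sum => t.
rewrite mulr_sumr; apply: Agr_sum => t'.
rewrite -scalerAl -scalerAr; do 2 apply: AgrZ.
have -> : word k t * word k t' = word k (t ++ t') by rewrite /word big_cat.
by rewrite -{1}(size_tuple t) -{1}(size_tuple t') -size_cat; apply: Agr_word.
Qed.

Lemma Agr_gen g : Agr 1 (gen g).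
Proof.
by have := Agr_word [:: g]; rewrite /word big_seq1.
Qed.

Lemma Agr_letter (x : letter n) : Agr (wt x) (letter_elt gen x).
Proof.
have V2A i : Agr 2 (V2elt gen i).
  by apply: (@AgrM 1 1); [apply: AgrB|]; apply: Agr_gen.
case: x => [|||i|i|i] //=; try exact: Agr_gen.
  apply: AgrD => //; apply: (@AgrM 1 1); last exact: Agr_gen.
  by apply: AgrB; apply: Agr_gen.
by apply: (@AgrM 1 2) => //; apply: AgrB; apply: Agr_gen.
Qed.

Lemma Agr_word_elt (s : seq (letter n)) : Agr (wts s) (word_elt gen s).
Proof.
elim: s => [|x s IHs].
  by have := Agr_word [::]; rewrite /word /word_elt !big_nil.
by rewrite word_elt_cons; apply: AgrM => //; apply: Agr_letter.
Qed.

Definition normal_span d x : Prop := exists c : seq (letter n) -> k,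
  x = \sum_(i : seq_sub (normal_words n d)) c (val i) *: word_elt gen (val i).

Lemma normal_spanD d x y :
  normal_span d x -> normal_span d y -> normal_span d (x + y).
Proof.
move=> [c ->] [e ->]; exists (fun t => c t + e t).
by rewrite -big_split; apply: eq_bigr => t _; rewrite scalerDl.
Qed.

Lemma normal_spanZ d c x : normal_span d x -> normal_span d (c *: x).
Proof.
move=> [e ->]; exists (fun t => c * e t).
by rewrite scaler_sumr; apply: eq_bigr => t _; rewrite scalerA.
Qed.

Lemma normal_spanB d x y :
  normal_span d x -> normal_span d y -> normal_span d (x - y).
Proof. by move=> Ax Ay; rewrite -scaleN1r; apply/normal_spanD/normal_spanZ. Qed.

Lemma normal_span_sum d (I : finType) (F : I -> A) :
  (forall i, normal_span d (F i)) -> normal_span d (\sum_i F i).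
Proof.
move=> AF; apply: big_ind => //; last exact: normal_spanD.
by exists (fun=> 0); rewrite big1 // => t _; rewrite scale0r.
Qed.

Lemma normal_span_word d s : sorted (@follows n) s -> wts s = d ->
  normal_span d (word_elt gen s).
Proof.
move=> s_sorted s_d.
have s_in : s \in normal_words n d by rewrite mem_normal_words s_sorted s_d /=.
exists (fun t => (t == s)%:R).
rewrite (bigD1 (SeqSub s_in)) //= eqxx scale1r big1 ?addr0 // => t ts.
by rewrite -[s]/(val (SeqSub s_in)) (inj_eq val_inj) (negPf ts) scale0r.
Qed.

Let relA := @dgen_rel k n.

(** In front of a normal word, rewriting ends after at most two steps, and the rules preserve the
    weight. *)
Lemma normal_span_gen_word d g s : sorted (@follows n) s -> wts s = d ->
  normal_span d.+1 (gen g * word_elt gen s).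
Proof.
move=> s_sorted <-; case: g => [[i|i]|].
- rewrite (mul_v_word relA).
  case: s s_sorted => [|[|||j|j|j] s] //= s_sorted;
    try by apply: normal_span_word.
  have [ij|nij] := boolP (incident i j).
    rewrite path_follows // in s_sorted.
    by apply: normal_spanD; apply: normal_span_word; rewrite //= path_follows.
  by apply: normal_span_word => //=; rewrite nij.
- by rewrite mul_w_word; apply: normal_span_word => //=; rewrite path_follows.
rewrite (mul_u_word relA).
case: s s_sorted => [|[|||j|j|j] s] //= s_sorted;
  try by apply: normal_span_word.
- apply: normal_spanB; last first.
    apply: normal_span_word => //=; rewrite path_follows //.
    exact: path_sorted s_sorted.
  apply: normal_spanD; last by apply: normal_span_word.
  (* The only second step: the new U2 meets a letter W. *)
  case: s s_sorted => [|[|||l|l|l] s] //= s_sorted;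
    try by apply: normal_span_word.
  move: s_sorted; rewrite path_follows // => /andP[_ s_sorted].
  apply: normal_spanB; [apply: normal_spanD|];
    by apply: normal_span_word; rewrite //= path_follows.
rewrite path_follows // in s_sorted.
by apply: normal_spanD; apply: normal_span_word; rewrite //= path_follows.
Qed.

Lemma normal_span_gen d g x : normal_span d x -> normal_span d.+1 (gen g * x).
Proof.
move=> [c ->]; rewrite mulr_sumr; apply: normal_span_sum => i.
rewrite -scalerAr; apply: normal_spanZ.
have := valP i; rewrite mem_normal_words => /andP[i_sorted /eqP i_d].
exact: normal_span_gen_word.
Qed.

Lemma Agr_normal_span d x : Agr d x <-> exists c : seq_sub (normal_words n d) -> k,
  x = \sum_i c i *: word_elt gen (val i).
Proof.
split=> [[c ->]|[c ->]]; last first.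
  apply: Agr_sum => i; apply: AgrZ.
  have := valP i; rewrite mem_normal_words => /andP[_ /eqP i_d].
  by have := Agr_word_elt (val i); rewrite i_d.
suff [e ->] : normal_span d (\sum_t c t *: word k t) by exists (e \o val).
apply: normal_span_sum => t; apply: normal_spanZ.
case: t => t /= /eqP <-; elim: t => [|g t IHt] /=.
  by have := @normal_span_word 0 [::] isT erefl; rewrite /word /word_elt !big_nil.
by rewrite /word big_cons; apply: normal_span_gen.
Qed.

End GradedBasis.

(** * The action of the dihedral group on normal words *)

Section ActionOnWords.
Variables (k : fieldType) (n : nat).
Hypothesis n_gt2 : (2 < n)%N.
Local Notation A := (dihAlg k n).
Local Notation gen := (@dgen k n).
Local Notation D := (dihedral n).

Definition edge_act (g : {perm 'Z_n}) i : 'Z_n := edge (g i) (g (i + 1)).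

Definition letter_act (g : {perm 'Z_n}) (x : letter n) : letter n :=
  match x with
  | U1 => U1 | U2 => U2 | U3 => U3
  | V1 i => V1 (edge_act g i) | V2 i => V2 (edge_act g i) | W i => W (g i)
  end.

Lemma incident_act g i : g \in D ->
  incident (edge_act g i) (g i) && incident (edge_act g i) (g (i + 1)).
Proof.
move=> /dihedral_adj[]/(_ i) gi; rewrite /edge_act gi.
  by rewrite edge_succ incident_refl incidentS.
by rewrite edge_pred // incident_refl -{2}[g i](subrK 1) incidentS.
Qed.

(** A reflection may exchange the roles of the two ends of an edge, and g moves the edge 0; the
    letters are still permuted because their values do not depend on the chosen vertex and edge. *)
Lemma letter_elt_act g x : g \in D ->
  letter_elt (gen \o gens_act g) x = letter_elt gen (letter_act g x).
Proof.
move=> Dg; have relA := @dgen_rel k n.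
have relg := @dact_rel k n n_gt2 g Dg.
have V2g i : V2elt (gen \o gens_act g) i = V2elt gen (edge_act g i).
  have /andP[gi _] := incident_act i Dg.
  by rewrite (V2elt_inc relA gi).
case: x => [|||i|i|i].
- by [].
- rewrite -[RHS](U2eltE relA (edge_act g 0)).
  by rewrite -V2g.
- rewrite -[RHS](U3eltE relA (edge_act g 0)).
  by rewrite -V2g.
- by [].
- exact: V2g.
by [].
Qed.

Definition dact_lrmorphism g (Dg : g \in D) : {lrmorphism A -> A} :=
  HB.pack (@dact k n g)
    (GRing.isLinear.Build k A A _ (dact g) (@dact_linear k n n_gt2 g Dg))
    (GRing.isMonoidMorphism.Build A A (dact g) (@dact_monoid k n n_gt2 g Dg)).

Lemma dact_word_elt g s : g \in D ->
  dact g (word_elt gen s) = word_elt gen (map (letter_act g) s).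
Proof.
move=> Dg; rewrite -[dact g]/(dact_lrmorphism Dg : A -> A) word_elt_morph.
rewrite {2}/word_elt big_map; apply: eq_bigr => x _.
rewrite -letter_elt_act //; apply: eq_letter_elt => y /=.
exact: dact_gen.
Qed.

Lemma incident_actE g i j : g \in D ->
  incident (edge_act g i) (g j) = incident i j.
Proof.
move=> Dg; have ij := incident_act _ Dg.
have e (l : 'Z_n) : incident i l -> incident (edge_act g i) (g l).
  by case/orP=> /eqP->; have /andP[] := ij i.
apply/idP/idP => [|/e //]; have /andP[] := ij i.
move: (perm_inj (s := g)); case/dihedral_adj: Dg => gD g_inj.
  by rewrite /edge_act !gD edge_succ /incident -gD !(inj_eq g_inj).
rewrite /edge_act !gD edge_pred // /incident subrK -gD !(inj_eq g_inj).
by move=> _ _; rewrite orbC.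
Qed.

Lemma follows_act g x y : g \in D ->
  follows (letter_act g x) (letter_act g y) = follows x y.
Proof. by move=> Dg; case: x y => [|||i|i|i] [|||j|j|j] //=; rewrite incident_actE. Qed.

Lemma map_letter_act_normal g d s : g \in D ->
  s \in normal_words n d -> map (letter_act g) s \in normal_words n d.
Proof.
move=> Dg; rewrite !mem_normal_words sorted_map => /andP[s_sorted /eqP <-].
rewrite (eq_sorted (fun x y => follows_act x y Dg)) s_sorted /=.
by rewrite /wts -map_comp; apply/eqP; congr sumn; apply: eq_map => -[].
Qed.

Definition fixed_words g d : nat :=
  count (fun s => map (letter_act g) s == s) (normal_words n d).

(** [Agr_repr] uses some unknown basis, so its trace is compared with that of the permutation of
    normal words. *)
Lemma tr_Agr_repr d g : g \in D ->
  \tr (Agr_repr k n_gt2 d g) = (fixed_words g d)%:R.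
Proof.
move=> Dg; rewrite /Agr_repr; case: cid => rG /= [b b_basis b_act].
pose sigma (i : seq_sub (normal_words n d)) : seq_sub (normal_words n d) :=
  SeqSub (map_letter_act_normal Dg (valP i)).
rewrite (mxtrace_permuted_basis (phi := dact_lrmorphism Dg)
  (f := fun i => word_elt gen (val i)) (sigma := sigma) b_basis).
- congr _%:R; rewrite /fixed_words -sum1_count [RHS]big_mkcond /=.
  rewrite -[RHS]sum_seq_sub ?normal_words_uniq //; exact: eq_bigr.
- by move=> i; apply: b_act.
- exact: Agr_normal_span.
- move=> c; apply: word_elt_free => [|i]; first exact: val_inj.
  by have := valP i; rewrite mem_normal_words => /andP[].
by move=> i; apply: dact_word_elt.
Qed.

End ActionOnWords.

(** * Counting fixed normal words *)

Definition shift (F : nat -> rat) m d : rat := if (m <= d)%N then F (d - m)%N else 0.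

Definition cubic (a1 a2 a3 : rat) : {poly rat} := a1 *: 'X + a2 *: 'X^2 + a3 *: 'X^3.

Lemma inv1B_cubic a1 a2 a3 (F : nat -> rat) :
    (forall d, F d = (d == 0)%:R + a1 * shift F 1 d + a2 * shift F 2 d
                     + a3 * shift F 3 d) ->
  F =1 inv1B (cubic a1 a2 a3).
Proof.
set q := cubic a1 a2 a3 => F_rec.
have q_coef i : q`_i = a1 * (i == 1)%:R + a2 * (i == 2)%:R + a3 * (i == 3)%:R.
  by rewrite !coefD !coefZ coefX !coefXn.
have sumE d m (G : nat -> rat) :
    \sum_(i < d) (i == m :> nat)%:R * G i = if (m < d)%N then G m else 0.
  case: ltnP => md.
    rewrite (bigD1 (Ordinal md)) //= eqxx mul1r big1 ?addr0 // => i im.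
    by rewrite -val_eqE /= in im; rewrite (negPf im) mul0r.
  rewrite big1 // => i _; case: eqP => [im|_]; last by rewrite mul0r.
  by have := ltn_ord i; rewrite im ltnNge md.
have q_rec d : inv1B q d = (d == 0)%:R + a1 * shift (inv1B q) 1 d
    + a2 * shift (inv1B q) 2 d + a3 * shift (inv1B q) 3 d.
  have q0 : q`_0 = 0 by rewrite q_coef !mulr0 !addr0.
  rewrite -(inv1BP d q0) big_ord_recl subn0 coefB coef1 q0 subr0 mul1r.
  have {1}-> : inv1B q d = inv1B q d + 0 by rewrite addr0.
  rewrite -!addrA; congr (_ + _); apply/esym/eqP; rewrite addr_eq0.
  rewrite /shift -!(sumE d _ (fun i => inv1B q (d - i.+1))) !mulr_sumr -!big_split -sumrN.
  apply/eqP/eq_bigr => i _ /=.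
  by rewrite coefB coef1 /= q_coef /bump /= add1n !eqSS; ring.
move=> d; elim/ltn_ind: d => d IHd.
have sh m : (0 < m)%N -> shift F m d = shift (inv1B q) m d.
  by rewrite /shift => m0; case: leqP => // md; rewrite IHd // ltn_subrL m0 (leq_trans m0).
by rewrite F_rec q_rec !sh.
Qed.

Section FixedWords.
Variables (n : nat) (fx : pred (letter n)).
Local Notation letter := (letter n).
Local Notation folls := (sorted (@follows n)).

Lemma count_sum (T : Type) (p : pred T) (r : seq T) : count p r = (\sum_(x <- r) p x)%N.
Proof. by elim: r => [|x r IHr] /=; rewrite ?big_nil // big_cons IHr. Qed.

(* The words counted have weight d - m; there are none when d < m.            *)
Definition nfixed d m : nat :=
  count (fun s => [&& folls s, all fx s & (wts s + m == d)%N]) (bounded_words n d).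

Definition nfixed_from x d m : nat :=
  count (fun s => [&& folls s, all fx s, (wts s + m == d)%N & ohead s == Some x])
    (bounded_words n d).

Lemma nfixed_split d m :
  nfixed d m = ((m == d) + \sum_x nfixed_from x d m)%N.
Proof.
have -> : (m == d : nat) = count (fun s => (s == [::]) && (m == d)) (bounded_words n d).
  case: (m == d); last first.
    by rewrite (eq_count (a2 := pred0)) ?count_pred0 // => s; rewrite andbF.
  rewrite (eq_count (a2 := pred1 [::])) => [|s]; last by rewrite andbT.
  by rewrite count_uniq_mem ?bounded_words_uniq // mem_bounded_words.
rewrite /nfixed /nfixed_from; under [X in (_ + X)%N]eq_bigr do rewrite count_sum.
rewrite exchange_big !count_sum -big_split /=; apply: eq_bigr => -[|y s] _ /=.
  by rewrite big1 ?addn0 // => x _; rewrite andbF.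
rewrite add0n (bigD1 y) //= eqxx andbT big1 ?addn0 // => x xy.
by rewrite (inj_eq (@Some_inj _)) (eq_sym y) (negPf xy) !andbF.
Qed.

(** Removing the first letter x leaves any word that does not begin with a letter forbidden after x.
    The forbidden words are added on the left to avoid subtraction in nat. *)
Lemma nfixed_from_cons x d m :
  (nfixed_from x d m
     + \sum_(y | ~~ follows x y) fx x * nfixed_from y d (m + wt x)
   = fx x * nfixed d (m + wt x))%N.
Proof.
have -> : nfixed_from x d m = (fx x * count (fun s => [&& path (@follows n) x s,
    all fx s & (wts s + (m + wt x) == d)%N]) (bounded_words n d))%N.
  case fx_x: (fx x); last first.
    rewrite mul0n /nfixed_from (eq_count (a2 := pred0)) ?count_pred0 //.
    move=> [|y s] /=; first by rewrite andbF.
    by case: (Some y =P Some x) => [[->]|_]; rewrite ?fx_x !andbF.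
  rewrite mul1n /nfixed_from -!size_filter -[RHS](size_map (cons x)).
  apply/perm_size/uniq_perm.
  - exact/filter_uniq/bounded_words_uniq.
  - rewrite map_inj_uniq; first exact/filter_uniq/bounded_words_uniq.
    by move=> ? ? [].
  move=> s; rewrite mem_filter mem_bounded_words; apply/andP/mapP.
    case: s => [|y s] [] /and4P[//= s_path /andP[_ s_fx] /eqP s_d /eqP[<-]] s_size.
    exists s => //; rewrite mem_filter mem_bounded_words s_path s_fx (ltnW s_size).
    by rewrite -s_d wts_cons andbT; apply/eqP; ring.
  case=> t; rewrite mem_filter mem_bounded_words => /andP[/and3P[t_path t_fx /eqP t_d] _] ->.
  have xt_d : (wts (x :: t) + m == d)%N by rewrite -t_d wts_cons; apply/eqP; ring.
  split; first by rewrite xt_d /= t_path fx_x t_fx eqxx.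
  apply: leq_trans (size_wts _) _; rewrite -(eqP xt_d); exact: leq_addr.
rewrite -big_distrr -mulnDr /=; congr (_ * _)%N.
rewrite /nfixed /nfixed_from; under [X in (_ + X)%N]eq_bigr do rewrite count_sum.
rewrite exchange_big !count_sum -big_split /=; apply: eq_bigr => -[|y s] _ /=.
  by rewrite big1 ?addn0 // => y _; rewrite andbF.
have [xy|xy] := boolP (follows x y); rewrite /=.
  rewrite big1 ?addn0 // => z xz.
  case: (Some y =P Some z) => [[yz]|_]; last by rewrite !andbF.
  by rewrite -yz xy in xz.
rewrite (bigD1 y) //= eqxx andbT big1 ?addn0 // => z /andP[_ zy].
by rewrite (inj_eq (@Some_inj _)) (eq_sym y) (negPf zy) !andbF.
Qed.

Lemma nfixed_sub d m : (m <= d)%N -> nfixed d m = nfixed (d - m)%N 0%N.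
Proof.
move=> md; rewrite /nfixed -!size_filter; apply/perm_size/uniq_perm.
- exact/filter_uniq/bounded_words_uniq.
- exact/filter_uniq/bounded_words_uniq.
move=> s; rewrite !mem_filter !mem_bounded_words addn0.
rewrite -(eqn_add2r m (wts s)) subnK //.
have [s_d|] := eqVneq (wts s + m)%N d; last by rewrite !andbF.
have s_size := size_wts s.
by rewrite -s_d addnK s_size (leq_trans s_size (leq_addr _ _)).
Qed.

Lemma nfixed_gt d m : (d < m)%N -> nfixed d m = 0%N.
Proof.
move=> dm; rewrite /nfixed (eq_count (a2 := pred0)) ?count_pred0 // => s /=.
by rewrite (gtn_eqF (leq_trans dm (leq_addl _ _))) !andbF.
Qed.

Hypotheses (fxU1 : fx U1) (fxU2 : fx U2) (fxU3 : fx U3).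
Hypothesis fxV : forall i, fx (V2 i) = fx (V1 i).

Definition fixed_faces : nat := (\sum_i fx (V1 i) + \sum_i fx (W i))%N.
Definition fixed_flags : nat := (\sum_i \sum_(j | incident i j) fx (V1 i) * fx (W j))%N.

(** The forbidden pairs have no cycle: nothing is forbidden after W, V2 and U3, only W after V1 and
    U2, only V1 and V2 after U1. So the counts by first letter can be eliminated successively, and
    the longest chain U1, V1, W has weight 3. *)
Lemma nfixed_ser d : (nfixed d 0%N)%:R
  = inv1B (cubic (1 + fixed_faces%:R) (1 - fixed_flags%:R)
       (1 - fixed_faces%:R + fixed_flags%:R)) d :> rat.
Proof.
move: d; apply: (@inv1B_cubic _ _ _ (fun d => (nfixed d 0%N)%:R)) => d.
have shE m : shift (fun d => (nfixed d 0%N)%:R) m d = (nfixed d m)%:R :> rat.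
  by rewrite /shift; case: leqP => [/nfixed_sub->|/nfixed_gt->].
rewrite !shE.
(* T m counts the fixed words of weight d - m, and S x m those among them that begin with x. *)
pose T m : rat := (nfixed d m)%:R; pose S x m : rat := (nfixed_from x d m)%:R.
have splitT : T 0%N = (0%N == d)%:R + \sum_x S x 0%N.
  by rewrite /T nfixed_split natrD natr_sum.
have SE x m : S x m = (fx x)%:R * T (m + wt x)%N
    - (fx x)%:R * \sum_(y | ~~ follows x y) S y (m + wt x)%N.
  have := congr1 (fun k => k%:R : rat) (nfixed_from_cons x d m).
  rewrite /= natrD natr_sum natrM => <-; rewrite /S mulr_sumr.
  by under [X in _ + X - _]eq_bigr do rewrite natrM; rewrite addrK.
have SW j m : S (W j) m = (fx (W j))%:R * T m.+1.
  by rewrite SE big_pred0 // mulr0 subr0 addn1.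
have SV2 i m : S (V2 i) m = (fx (V1 i))%:R * T m.+2.
  by rewrite SE big_pred0 // mulr0 subr0 addn2 fxV.
have SU3 m : S U3 m = T m.+3.
  by rewrite SE big_pred0 // mulr0 subr0 addn3 fxU3 mul1r.
pose Nv : rat := \sum_i (fx (V1 i))%:R; pose Nw : rat := \sum_i (fx (W i))%:R.
pose M i : rat := \sum_(j | incident i j) (fx (W j))%:R.
have SV1 i m : S (V1 i) m = (fx (V1 i))%:R * (T m.+1 - M i * T m.+2).
  rewrite SE big_mkcond sum_letter /= addn1 !big1_eq !add0r mulrBr.
  congr (_ - _ * _); rewrite mulr_suml [RHS]big_mkcond; apply: eq_bigr => j _.
  by rewrite negbK SW.
have SU2 m : S U2 m = T m.+2 - Nw * T m.+3.
  rewrite SE big_mkcond sum_letter /= addn2 !big1_eq !add0r fxU2 !mul1r.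
  by congr (_ - _); rewrite mulr_suml; apply: eq_bigr => j _; rewrite SW.
have SU1 m : S U1 m = T m.+1 - (Nv * T m.+2 - fixed_flags%:R * T m.+3) - Nv * T m.+3.
  rewrite SE big_mkcond sum_letter /= addn1 !big1_eq.
  rewrite !add0r addr0 fxU1 !mul1r opprD addrA; congr (_ - _ - _); last first.
    by rewrite mulr_suml; apply: eq_bigr => i _; rewrite SV2.
  rewrite /fixed_flags natr_sum !mulr_suml -sumrB; apply: eq_bigr => i _.
  rewrite SV1 mulrBr mulrA; congr (_ - _ * _).
  by rewrite natr_sum mulr_sumr; apply: eq_bigr => j _; rewrite natrM.
have SV1sum : \sum_i S (V1 i) 0%N = Nv * T 1%N - fixed_flags%:R * T 2%N.
  rewrite /fixed_flags natr_sum !mulr_suml -sumrB; apply: eq_bigr => i _.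
  rewrite SV1 mulrBr mulrA; congr (_ - _ * _).
  by rewrite natr_sum mulr_sumr; apply: eq_bigr => j _; rewrite natrM.
transitivity ((d == 0%N)%:R + (1 + fixed_faces%:R) * T 1%N
  + (1 - fixed_flags%:R) * T 2%N + (1 - fixed_faces%:R + fixed_flags%:R) * T 3%N);
  last by [].
have SV2sum : \sum_i S (V2 i) 0%N = Nv * T 2%N.
  by rewrite mulr_suml; apply: eq_bigr => i _; rewrite SV2.
have SWsum : \sum_i S (W i) 0%N = Nw * T 1%N.
  by rewrite mulr_suml; apply: eq_bigr => i _; rewrite SW.
have -> : fixed_faces%:R = Nv + Nw by rewrite natrD !natr_sum.
transitivity (T 0%N); first by [].
clear SW SV2 SV1 SE shE; clearbody T S Nv Nw M.
rewrite splitT sum_letter SU1 SU2 SU3 SV1sum SV2sum SWsum eq_sym.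
by ring.
Qed.

End FixedWords.

(** * Fixed words of the elements of the dihedral group *)

Section FixedByDihedral.
Variables (n : nat).
Hypothesis n_gt2 : (2 < n)%N.
Local Notation D := (dihedral n).
Implicit Types (g : {perm 'Z_n}) (a i : 'Z_n).

Definition fixes g (x : letter n) : bool := letter_act g x == x.

Lemma fixed_words_nfixed g d : fixed_words g d = nfixed (fixes g) d 0%N.
Proof.
rewrite /fixed_words /normal_words count_filter; apply: eq_count => s /=.
rewrite addn0 andbCA; congr (_ && (_ && _)).
by elim: s => //= x s <-; rewrite eqseq_cons.
Qed.

Lemma fixesV1 g i : fixes g (V1 i) = (edge_act g i == i).
Proof. by []. Qed.
Lemma fixesW g i : fixes g (W i) = (g i == i).
Proof. by []. Qed.

Lemma fixed_words_ser g d : (fixed_words g d)%:R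
  = inv1B (cubic (1 + (fixed_faces (fixes g))%:R) (1 - (fixed_flags (fixes g))%:R)
       (1 - (fixed_faces (fixes g))%:R + (fixed_flags (fixes g))%:R)) d :> rat.
Proof. by rewrite fixed_words_nfixed nfixed_ser. Qed.

Lemma card_Zn : (Zp_trunc n).+2 = n.
Proof. by apply: Zp_cast; apply: ltnW. Qed.

Lemma fixed_words1 d : (fixed_words (1%g : {perm 'Z_n}) d)%:R = ser_a n d.
Proof.
have fix_edge i : edge_act 1 i = i by rewrite /edge_act !perm1 edge_succ.
rewrite fixed_words_ser /ser_a.
have -> : fixed_faces (fixes 1) = (2 * n)%N.
  rewrite /fixed_faces (eq_bigr (fun=> 1%N)) => [|i _]; last first.
    by rewrite fixesV1 fix_edge eqxx.
  rewrite [X in (_ + X)%N](eq_bigr (fun=> 1%N)) => [|i _]; last first.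
    by rewrite fixesW perm1 eqxx.
  by rewrite sum1_card card_ord card_Zn mul2n addnn.
have -> : fixed_flags (fixes 1) = (2 * n)%N.
  rewrite /fixed_flags (eq_bigr (fun=> 2%N)) => [|i _]; last first.
    rewrite (eq_bigr (fun=> 1%N)) => [|j _]; last first.
      by rewrite fixesV1 fixesW fix_edge perm1 !eqxx.
    rewrite sum1_card (eq_card (B := pred2 i (i + 1))) // card2.
    by rewrite -subr_eq0 opprD addNKr oppr_eq0 oner_eq0.
  by rewrite sum_nat_const card_ord card_Zn mulnC.
congr (inv1B _ d); rewrite /cubic -scaleNr -[X in _ = _ + X]scale1r.
by congr (_ *: _ + _ *: _ + _ *: _); rewrite natrM; ring.
Qed.

Lemma fixed_words_rot g a d : a != 0 -> (forall i, g i = a + i) ->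
  (fixed_words g d)%:R = ser_b d.
Proof.
move=> a0 gE; have g_i i : (g i == i) = false.
  by rewrite gE -subr_eq0 addrK (negPf a0).
have edge_i i : (edge_act g i == i) = false.
  by rewrite /edge_act !gE addrA edge_succ -gE g_i.
rewrite fixed_words_ser /ser_b.
have -> : fixed_faces (fixes g) = 0%N.
  by rewrite /fixed_faces !big1 // => i _; rewrite ?fixesV1 ?fixesW ?edge_i ?g_i.
have -> : fixed_flags (fixes g) = 0%N.
  by rewrite /fixed_flags big1 // => i _; rewrite big1 // => j _; rewrite fixesV1 edge_i.
congr (inv1B _ d); rewrite /cubic !(mulr0n, addr0, subr0).
by rewrite !scale1r.
Qed.

Lemma sum_double (F : nat -> nat) m :
  (\sum_(i < m) (F (i.*2) + F (i.*2.+1)) = \sum_(i < m + m) F i)%N.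
Proof.
rewrite addnn; elim: m => [|m IHm]; first by rewrite !big_ord0.
by rewrite big_ord_recr /= IHm doubleS !big_ord_recr /= addnA.
Qed.

(** Treats both parities of n at once: the numbers 2i and 2i + 1 for i < n run through 0, ..., 2n -
    1, so they meet each residue exactly twice. In [fixed_words_ref] these terms count the fixed
    vertices and the fixed edges. *)
Lemma sum_double_Zn a :
  (\sum_i (((i + i)%R == a) + ((i + i + 1)%R == a)) = 2)%N.
Proof.
pose F m : nat := (m%:R == a).
have FE m : F (m + (Zp_trunc n).+2)%N = F m.
  by rewrite /F natrD !Zp_nat; congr (_ == _); apply/val_inj; rewrite /= modnn addn0 modn_mod.
have F1 : (\sum_(i < (Zp_trunc n).+2) F i = 1)%N.
  rewrite (bigD1 a) //= /F natr_Zp eqxx big1 // => i ia.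
  by rewrite natr_Zp (negPf ia).
transitivity (\sum_(i < (Zp_trunc n).+2) (F (i.*2) + F (i.*2.+1)))%N.
  by apply: eq_bigr => i _; rewrite /F -(addn1 i.*2) -(addnn i) !natrD natr_Zp.
rewrite sum_double big_split_ord /= F1.
by under eq_bigr do rewrite addnC FE; rewrite F1.
Qed.

Lemma fixed_words_ref g a d : (forall i, g i = a - i) ->
  (fixed_words g d)%:R = ser_c d.
Proof.
move=> gE.
have edgeE i : edge_act g i = a - i - 1.
  by rewrite /edge_act !gE opprD addrA edge_pred.
have g_i i : (g i == i) = (i + i == a) by rewrite gE subr_eq eq_sym.
have edge_i i : (edge_act g i == i) = (i + i + 1 == a).
  by rewrite edgeE -addrA -opprD subr_eq eq_sym addrA.
rewrite fixed_words_ser /ser_c.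
have -> : fixed_faces (fixes g) = 2%N.
  rewrite -(sum_double_Zn a) big_split /= addnC.
  by congr (_ + _)%N; apply: eq_bigr => i _; rewrite ?fixesV1 ?fixesW ?edge_i ?g_i.
(* A fixed incident pair would give 2i + 1 = a = 2j with j = i or j = i + 1, hence 1 = 0. *)
have -> : fixed_flags (fixes g) = 0%N.
  rewrite /fixed_flags big1 // => i _; rewrite big1 // => j ij.
  rewrite fixesV1 fixesW edge_i g_i; apply/eqP; rewrite muln_eq0 !eqb0 -negb_and.
  apply/negP => /andP[/eqP <-]; case/orP: ij => /eqP->.
    by rewrite eq_sym -subr_eq0 addrAC subrr add0r oner_eq0.
  by rewrite addrACA (inj_eq (addrI _)) -subr_eq0 addrK oner_eq0.
rewrite -[3 *: 'X + 'X^2 - 'X^3]/(3 *: 'X + 'X^2 + - 'X^3) -scaleN1r.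
rewrite -['X^2 in RHS]scale1r -/(cubic 3 1 (-1)).
by congr (inv1B (cubic _ _ _) d); ring.
Qed.

Lemma drotXE m i : (drot n ^+ m)%g i = i + m%:R.
Proof.
elim: m => [|m IHm]; first by rewrite expg0 perm1 addr0.
by rewrite expgSr permM IHm drotE -(addn1 m) natrD addrA.
Qed.

Lemma drotX_drefE m i : (drot n ^+ m * dref n)%g i = 3%:R - m%:R - i.
Proof. by rewrite permM drotXE drefE opprD addrA addrAC. Qed.

Lemma drot_dihedral : drot n \in D.
Proof. by apply/mem_gen; rewrite !inE eqxx. Qed.

Lemma dref_dihedral : dref n \in D.
Proof. by apply/mem_gen; rewrite !inE eqxx orbT. Qed.

(** By [dihedral_adj] an element is determined by its value at 0 and its orientation; a rotation
    that equals a reflection would force 2 = 0. *)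
Lemma sum_dihedral (R : nmodType) (F : {perm 'Z_n} -> R) :
  \sum_(g in D) F g
    = \sum_(i : 'Z_n) F (drot n ^+ i)%g + \sum_(i : 'Z_n) F (drot n ^+ i * dref n)%g.
Proof.
pose h (x : 'Z_n + 'Z_n) : {perm 'Z_n} :=
  match x with inl i => drot n ^+ i | inr i => drot n ^+ i * dref n end%g.
have h_inj : injective h.
  move=> [i|i] [j|j] /permP hij.
  - by have := hij 0; rewrite /= !drotXE !add0r !natr_Zp => ->.
  - have := hij 1; have := hij 0; rewrite /= !drotXE !drotX_drefE add0r subr0.
    move=> ->; rewrite [LHS]addrC => /addrI/eqP; rewrite -subr_eq0 opprK.
    by rewrite (negPf (Zn2_neq0 n_gt2)).
  - have := hij 1; have := hij 0; rewrite /= !drotXE !drotX_drefE add0r subr0.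
    move=> ->; rewrite [RHS]addrC => /addrI/eqP; rewrite eq_sym -subr_eq0 opprK.
    by rewrite (negPf (Zn2_neq0 n_gt2)).
  - have := hij 0; rewrite /= !drotX_drefE !subr0 !natr_Zp.
    by move/addrI/oppr_inj => ->.
have hD : D = h @: setT :> {set _}.
  apply/setP => g; apply/idP/imsetP => [Dg|[[i|i] _ ->]]; last first.
  - by rewrite /= groupM ?groupX ?drot_dihedral ?dref_dihedral.
  - by rewrite /= groupX ?drot_dihedral.
  case/dihedral_adj: Dg => gS.
    exists (inl (g 0)) => //; apply/permP; elim/Zn_ind => [|i].
      by rewrite /= drotXE add0r natr_Zp.
    by rewrite /= !drotXE gS => ->; rewrite addrAC.
  (* The exponent solves 3 - c = g 0, as r^c s sends i to 3 - c - i. *)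
  pose c : 'Z_n := 3%:R - g 0; exists (inr c) => //.
  apply/permP; elim/Zn_ind => [|i]; rewrite -[h _]/(drot n ^+ c * dref n)%g.
    by rewrite drotX_drefE natr_Zp subr0 /c subKr.
  by rewrite !drotX_drefE gS => ->; rewrite opprD addrA.
rewrite hD big_imset /=; last by move=> x y _ _ /h_inj.
by under eq_bigl do rewrite inE; rewrite big_sumType.
Qed.

Lemma card_dihedral : #|D| = (2 * n)%N.
Proof.
by rewrite -sum1_card sum_dihedral !sum1_card card_ord card_Zn mul2n -addnn.
Qed.

End FixedByDihedral.

(** * Multiplicities of the irreducible representations of D_n *)

Section Multiplicities.
Variables (k : fieldType) (n : nat).
Hypothesis n_gt2 : (2 < n)%N.
Hypothesis k_char0 : [pchar k] =i pred0.
Hypothesis k_split : group_splitting_field k (dihedral n).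
Local Notation D := (dihedral n).
Local Notation r := (drot n).
Local Notation s := (dref n).

(** Carries the character identities from k to nat, and from there to rat where the series live. *)
Lemma pchar0_natr_inj : injective (fun m : nat => m%:R : k).
Proof.
move=> m p; wlog mp : m p / (m <= p)%N => [wlog_le|] eq_mp.
  have [/wlog_le->//|/ltnW/wlog_le e] := leqP m p.
  by rewrite -e.
apply/eqP; rewrite eqn_leq mp /= -subn_eq0 -((pcharf0P k).1 k_char0) natrB //.
by rewrite eq_mp subrr.
Qed.

Lemma fixed_words_rotX i d : i != 0 ->
  fixed_words (r ^+ (i : 'Z_n))^-1%g d = fixed_words r d.
Proof.
move=> i0; apply/eqP; rewrite -(Num.Theory.eqr_nat rat).
rewrite (@fixed_words_rot _ _ (- i)) ?oppr_eq0 // => [|j].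
  rewrite (@fixed_words_rot _ _ 1) ?oner_eq0 // => j.
  by rewrite drotE addrC.
by apply: (canLR (permK _)); rewrite drotXE natr_Zp addrAC addNr add0r.
Qed.

Lemma fixed_words_refX i d :
  fixed_words (r ^+ (i : 'Z_n) * s)^-1%g d = fixed_words s d.
Proof.
apply/eqP; rewrite -(Num.Theory.eqr_nat rat).
rewrite (@fixed_words_ref _ n_gt2 _ (3%:R - i)) => [|j].
  by rewrite (@fixed_words_ref _ n_gt2 _ 3%:R) // => j; rewrite drefE.
by apply: (canLR (permK _)); rewrite drotX_drefE natr_Zp subKr.
Qed.

Lemma mx_mult_dihedral (phi : representation k D) d : mx_irreducible phi ->
  (2 * n * mx_mult phi (Agr_repr k n_gt2 d))%:R
    = \tr (phi 1%g) * (fixed_words (1%g : {perm 'Z_n}) d)%:R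
      + (\sum_(i : 'Z_n | i != 0) \tr (phi (r ^+ i)%g)) * (fixed_words r d)%:R
      + (\sum_(i : 'Z_n) \tr (phi (r ^+ i * s)%g)) * (fixed_words s d)%:R.
Proof.
move=> /k_split abs_phi; rewrite natrM mx_mult_inner // card_dihedral //.
rewrite mulVKf ?pchar0_natf_neq0 ?muln_gt0 ?(ltnW (ltnW n_gt2)) //.
(* The inverse moves from phi to the word count, which takes the same value at inverse elements. *)
rewrite (reindex_inj invg_inj) /=.
under eq_bigl do rewrite groupV.
under eq_bigr => g Dg do rewrite invgK tr_Agr_repr ?groupV //.
rewrite sum_dihedral // (bigD1 0) //= expg0 invg1 !mulr_suml.
congr (_ + _ + _); apply: eq_bigr => i i0.
  by rewrite fixed_words_rotX.
by rewrite fixed_words_refX.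
Qed.

Lemma sum_expr_Zn (F : fieldType) (x : F) : x != 1 -> x ^+ n = 1 ->
  \sum_(i : 'Z_n) x ^+ i = 0.
Proof.
move=> x1 xn; have := subrX1 x (Zp_trunc n).+2; rewrite {1}card_Zn // xn subrr.
by move/esym/eqP; rewrite mulf_eq0 subr_eq0 (negPf x1) => /eqP.
Qed.

Lemma sum_expr1_Zn : \sum_(i : 'Z_n) 1 ^+ i = n%:R :> k.
Proof.
under eq_bigr do rewrite expr1n.
by rewrite sumr_const card_ord card_Zn.
Qed.

Section Linear.
Variables (e1 e2 : k) (phi : representation k D).
Hypothesis phi_irr : mx_irreducible phi.
Hypothesis phi_lin : char_lin e1 e2 phi.

Lemma mx_mult_lin d : (2 * n * mx_mult phi (Agr_repr k n_gt2 d))%:R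
  = (fixed_words (1%g : {perm 'Z_n}) d)%:R
    + (\sum_(i : 'Z_n) e1 ^+ i - 1) * (fixed_words r d)%:R
    + (\sum_(i : 'Z_n) e1 ^+ i) * e2 * (fixed_words s d)%:R.
Proof.
rewrite mx_mult_dihedral //; have [/= -> _] := phi_lin 0; rewrite expr0 mul1r.
congr (_ + _ * _ + _ * _).
  rewrite [in RHS](bigD1 0) //= expr0 [RHS]addrC addKr.
  by apply: eq_bigr => i _; have [->] := phi_lin i.
by rewrite mulr_suml; apply: eq_bigr => i _; have [_ ->] := phi_lin i.
Qed.

(** The powers of e1 sum to 0, so reflections contribute nothing and the nontrivial rotations
    contribute with coefficient -1. *)
Lemma mx_mult_lin_nontrivial d : e1 != 1 -> e1 ^+ n = 1 ->
  (2 * n * mx_mult phi (Agr_repr k n_gt2 d) + fixed_words r d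
   = fixed_words (1%g : {perm 'Z_n}) d)%N.
Proof.
move=> e11 e1n; apply: pchar0_natr_inj; rewrite natrD mx_mult_lin sum_expr_Zn //.
by rewrite sub0r mulN1r !mul0r addr0 subrK.
Qed.

End Linear.

Lemma mx_mult_triv (phi : representation k D) d :
    mx_irreducible phi -> char_lin 1 1 phi ->
  (2 * n * mx_mult phi (Agr_repr k n_gt2 d)
   = fixed_words (1%g : {perm 'Z_n}) d + (n - 1) * fixed_words r d
     + n * fixed_words s d)%N.
Proof.
move=> phi_irr phi_lin; apply: pchar0_natr_inj; rewrite (mx_mult_lin phi_irr phi_lin).
rewrite sum_expr1_Zn !natrD !natrM natrB ?(ltnW (ltnW n_gt2)) //.
by rewrite mulr1.
Qed.

Lemma mx_mult_sign (phi : representation k D) d :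
    mx_irreducible phi -> char_lin 1 (-1) phi ->
  (2 * n * mx_mult phi (Agr_repr k n_gt2 d) + n * fixed_words s d
   = fixed_words (1%g : {perm 'Z_n}) d + (n - 1) * fixed_words r d)%N.
Proof.
move=> phi_irr phi_lin; apply: pchar0_natr_inj.
rewrite natrD (mx_mult_lin phi_irr phi_lin).
rewrite sum_expr1_Zn !natrD !natrM natrB ?(ltnW (ltnW n_gt2)) //.
by rewrite mulrN1 mulNr subrK.
Qed.

(** Since z^j and its inverse are nontrivial n-th roots of unity, the character sums to 0 over the
    rotations; this is seen in L and pulled back along the injective iota. *)
Lemma mx_mult_two (L : fieldType) (iota : {rmorphism k -> L}) (z : L) j
    (phi : representation k D) d :
    n.-primitive_root z -> (0 < j < n)%N ->
    mx_irreducible phi -> char_two iota z j phi ->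
  (2 * n * mx_mult phi (Agr_repr k n_gt2 d) + 2 * fixed_words r d
   = 2 * fixed_words (1%g : {perm 'Z_n}) d)%N.
Proof.
move=> z_prim /andP[j_gt0 j_ltn] phi_irr phi_two; apply: pchar0_natr_inj.
have zj1 : z ^+ j != 1.
  by rewrite -(prim_order_dvd z_prim) gtnNdvd.
have zjn : (z ^+ j) ^+ n = 1 by rewrite exprAC (prim_expr_order z_prim) expr1n.
have tr1 : \tr (phi 1%g) = 2%:R.
  apply: (fmorph_inj iota); have [/= -> _] := phi_two 0.
  by rewrite mul0n expr0 invr1 rmorph_nat.
have tr_rot : \sum_(i : 'Z_n) \tr (phi (r ^+ i)%g) = 0.
  apply: (fmorph_inj iota); rewrite rmorph0 rmorph_sum.
  transitivity (\sum_(i : 'Z_n) (z ^+ j) ^+ i + \sum_(i : 'Z_n) ((z ^+ j)^-1) ^+ i).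
    rewrite -big_split; apply: eq_bigr => i _ /=; have [-> _] := phi_two i.
    by rewrite exprVn -!exprM mulnC.
  by rewrite !sum_expr_Zn ?addr0 // ?invr_eq1 // exprVn zjn invr1.
rewrite natrD mx_mult_dihedral // tr1 [X in _ * _ + _ * _ + X * _]big1; last first.
  by move=> i _; have [] := phi_two i.
move: tr_rot; rewrite (bigD1 0) //= tr1 => /eqP; rewrite addrC addr_eq0 => /eqP->.
by rewrite mul0r addr0 !natrM mulNr subrK.
Qed.

End Multiplicities.

Theorem proposition7p1 (k : fieldType) (n : nat) (n_gt2 : (2 < n)%N)
    (k_char0 : [pchar k] =i pred0)
    (k_split : group_splitting_field k (dihedral n))
    (L : fieldType) (iota : {rmorphism k -> L}) (z : L)
    (z_prim : n.-primitive_root z) :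
  let a := ser_a n in let b := ser_b in let c := ser_c in
  let N : rat := n%:R in
  let m_triv d := (2 * N)^-1 * a d + (N - 1) / (2 * N) * b d + 2^-1 * c d in
  let m_1m1 d := (2 * N)^-1 * a d + (N - 1) / (2 * N) * b d - 2^-1 * c d in
  let m_lin d := (2 * N)^-1 * (a d - b d) in
  let m_two d := N^-1 * (a d - b d) in
  (~~ odd n ->
    [/\ has_graded_mult k n_gt2 (char_lin 1 1) m_triv,
        has_graded_mult k n_gt2 (char_lin 1 (-1)) m_1m1,
        has_graded_mult k n_gt2 (char_lin (-1) 1) m_lin,
        has_graded_mult k n_gt2 (char_lin (-1) (-1)) m_lin
      & forall j : nat, (1 <= j <= n./2 - 1)%N ->
          has_graded_mult k n_gt2 (char_two iota z j) m_two]) /\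
  (odd n ->
    [/\ has_graded_mult k n_gt2 (char_lin 1 1) m_triv,
        has_graded_mult k n_gt2 (char_lin 1 (-1)) m_1m1
      & forall j : nat, (1 <= j <= (n - 1)./2)%N ->
          has_graded_mult k n_gt2 (char_two iota z j) m_two]).
Proof.
move=> a b c N m_triv m_1m1 m_lin m_two.
have n_gt0 : (0 < n)%N := ltnW (ltnW n_gt2).
have N0 : N != 0 by rewrite Num.Theory.pnatr_eq0 -lt0n.
have aE d : (fixed_words (1%g : {perm 'Z_n}) d)%:R = a d by apply: fixed_words1.
have bE d : (fixed_words (drot n) d)%:R = b d.
  by apply: (@fixed_words_rot _ _ 1) => [|i]; rewrite ?oner_eq0 // drotE addrC.
have cE d : (fixed_words (dref n) d)%:R = c d.
  by apply: (@fixed_words_ref _ n_gt2 _ 3%:R) => i; apply: drefE.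
have triv : has_graded_mult k n_gt2 (char_lin 1 1) m_triv.
  move=> phi phi_irr phi_lin d.
  have := mx_mult_triv n_gt2 k_char0 k_split d phi_irr phi_lin.
  move/(congr1 (fun m => m%:R : rat)).
  rewrite /= !natrD !natrM natrB // aE bE cE -/(graded_mult _ _) -/N => mE.
  by apply: (mulfI (x := 2 * N)); rewrite ?mulf_neq0 // mE /m_triv; field.
have sign : has_graded_mult k n_gt2 (char_lin 1 (-1)) m_1m1.
  move=> phi phi_irr phi_lin d.
  have := mx_mult_sign n_gt2 k_char0 k_split d phi_irr phi_lin.
  move/(congr1 (fun m => m%:R : rat)).
  rewrite /= !natrD !natrM natrB // aE bE cE -/(graded_mult _ _) -/N.
  move/(canRL (addrK _)) => mE.
  by apply: (mulfI (x := 2 * N)); rewrite ?mulf_neq0 // mE /m_1m1; field.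
have lin e : ~~ odd n -> has_graded_mult k n_gt2 (char_lin (-1) e) m_lin.
  move=> n_even phi phi_irr phi_lin d.
  have m1_neq1 : -1 != 1 :> k.
    by rewrite eq_sym -subr_eq0 opprK (pchar0_natf_neq0 k_char0 (m := 2)).
  have m1_n : (-1) ^+ n = 1 :> k by rewrite -signr_odd (negPf n_even) expr0.
  have := mx_mult_lin_nontrivial n_gt2 k_char0 k_split phi_irr phi_lin d m1_neq1 m1_n.
  move/(congr1 (fun m => m%:R : rat)).
  rewrite /= !natrD !natrM aE bE -/(graded_mult _ _) -/N.
  move/(canRL (addrK _)) => mE.
  by apply: (mulfI (x := 2 * N)); rewrite ?mulf_neq0 // mE /m_lin; field.
have two j : (0 < j < n)%N -> has_graded_mult k n_gt2 (char_two iota z j) m_two.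
  move=> j_n phi phi_irr phi_two d.
  have := mx_mult_two n_gt2 k_char0 k_split d z_prim j_n phi_irr phi_two.
  move/(congr1 (fun m => m%:R : rat)).
  rewrite /= !natrD !natrM aE bE -/(graded_mult _ _) -/N.
  move/(canRL (addrK _)) => mE.
  by apply: (mulfI (x := 2 * N)); rewrite ?mulf_neq0 // mE /m_two; field.
split=> n_parity; split=> //; try exact: lin.
  by move=> j j_n; apply: two; lia.
by move=> j j_n; apply: two; lia.
Qed.
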